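(* Let $X_1,\dots,X_p$ be independent random variables, $X_i$ valued in a measurable space $E_i$, let $f:E_1\times\dots\times E_p\to\mathbb R^k$ be measurable, and let $Y=f(X_1,\dots,X_p)$, with components $Y_{(1)},\dots,Y_{(k)}$, have positive definite covariance matrix. Assume that $\mathbb E(Y_{(l)}^4)<\infty$ for all $l=1,\dots,k$. Let $\mathbf u\subset\{1,\dots,p\}$. For $l=1,\dots,k$ set $$U_l=(Y_{1,l}-\mathbb E(Y_{(l)}))(Y_{1,l}^{\mathbf u}-\mathbb E(Y_{(l)})),\qquad V_l=(Y_{1,l}-\mathbb E(Y_{(l)}))^2+(Y_{1,l}^{\mathbf u}-\mathbb E(Y_{(l)}))^2 .$$ Then $$\sqrt N\left(S_{\mathbf u,N}-S^{\mathbf u}(f)\right)\xrightarrow[N\to\infty]{\mathcal L}\mathcal N_1(0,\sigma^2),$$ where $$\sigma^2=a^2\sum_{l,l'\in\{1,\dots,k\}}\mathrm{Cov}(U_l,U_{l'})+b^2\sum_{l,l'\in\{1,\dots,k\}}\mathrm{Cov}(V_l,V_{l'})+2ab\sum_{l,l'\in\{1,\dots,k\}}\mathrm{Cov}(U_l,V_{l'}),$$ with $$a=\frac1{\sum_{l=1}^k\mathrm{Var}(Y_{(l)})},\qquad b=-\frac a2S^{\mathbf u}(f).$$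
   Context: For $\mathbf u\subset\{1,\dots,p\}$, $X_{\mathbf u}=(X_i,\ i\in\mathbf u)$ and $\sim\!\mathbf u$ is the complement of $\mathbf u$. $\Sigma$ is the covariance matrix of $Y$, $C_{\mathbf u}$ is the covariance matrix of $\mathbb E(Y\mid X_{\mathbf u})$, and $S^{\mathbf u}(f)=\mathrm{Tr}(C_{\mathbf u})/\mathrm{Tr}(\Sigma)$. Set $Y^{\mathbf u}=f(X_{\mathbf u},X'_{\sim\mathbf u})$, where $X'_{\sim\mathbf u}$ is an independent copy of $X_{\sim\mathbf u}$, also independent of $X_{\mathbf u}$. Let $(Y_i,Y_i^{\mathbf u})_{i\ge1}$ be i.i.d. copies of the pair $(Y,Y^{\mathbf u})$, and let $Y_{i,l}$, $Y_{i,l}^{\mathbf u}$ be the $l$-th components of $Y_i$, $Y_i^{\mathbf u}$. The Pick and Freeze estimator is $$S_{\mathbf u,N}=\frac{\sum_{l=1}^k\left(\frac1N\sum_{i=1}^NY_{i,l}Y_{i,l}^{\mathbf u}-\left(\frac1N\sum_{i=1}^N\frac{Y_{i,l}+Y_{i,l}^{\mathbf u}}2\right)^2\right)}{\sum_{l=1}^k\left(\frac1N\sum_{i=1}^N\frac{Y_{i,l}^2+(Y_{i,l}^{\mathbf u})^2}2-\left(\frac1N\sum_{i=1}^N\frac{Y_{i,l}+Y_{i,l}^{\mathbf u}}2\right)^2\right)} .$$ $\mathcal N_1(0,\sigma^2)$ is the one-dimensional Gaussian law (the Dirac mass at $0$ if $\sigma^2=0$), and $\xrightarrow{\mathcal L}$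 is convergence in distribution. *)

(* Defs.v *)
From HB Require Import structures.
From mathcomp Require Import all_boot all_order all_algebra finmap.
From mathcomp Require Import all_classical all_reals all_analysis.

Set Implicit Arguments.
Unset Strict Implicit.
Unset Printing Implicit Defensive.

Import Order.TTheory GRing.Theory Num.Theory.
Import numFieldNormedType.Exports.

Local Open Scope classical_set_scope.
Local Open Scope ring_scope.

Section product_space.
Context (I : Type) (d : I -> measure_display) (E : forall i, measurableType (d i)).

Definition cylinder : set (set (forall i, E i)) :=
  \bigcup_i preimage_set_system setT (fun x : forall i, E i => x i) measurable.

(* g_sigma_algebraType makes this a measurableType whose sigma-algebra is the
   product one; elements are still dependent functions. *)
Definition product_space := g_sigma_algebraType cylinder.

End product_space.

Section coordinates.
Context (p : nat) (d : 'I_p -> measure_display)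
  (E : forall i, measurableType (d i)).

Definition subproduct (u : {set 'I_p}) :=
  product_space (fun i : {i : 'I_p | i \in u} => E (sval i)).

Definition subvector (u : {set 'I_p}) (x : product_space E) : subproduct u :=
  fun i => x (sval i).

Fact mem_compl (u : {set 'I_p}) (i : 'I_p) : i \notin u -> i \in (~: u)%SET.
Proof. by rewrite finset.in_setC. Qed.

(* The point with coordinates x on u and y off u. *)
Definition pf_merge (u : {set 'I_p}) (x : subproduct u) (y : subproduct (~: u)%SET) :
    product_space E :=
  fun i => match boolP (i \in u) with
           | AltTrue iu => x (exist _ i iu)
           | AltFalse iu => y (exist _ i (mem_compl iu))
           end.

End coordinates.
Arguments subvector {p d E} u x.

Section probability.
Context (R : realType) (dO : measure_display) (Omega : measurableType dO)
  (P : probability Omega R).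
Local Open Scope ereal_scope.

Definition mutually_independent (I : choiceType) (d : I -> measure_display)
    (E : forall i, measurableType (d i)) (X : forall i, Omega -> E i) :=
  forall (J : {fset I}) (A : forall i, set (E i)),
    (forall i, i \in J -> measurable (A i)) ->
    P (\bigcap_(i in [set` J]) (X i @^-1` A i)) =
    \prod_(i <- J) P (X i @^-1` A i).

Definition independent2 d1 d2 (E1 : measurableType d1) (E2 : measurableType d2)
    (X1 : Omega -> E1) (X2 : Omega -> E2) :=
  forall A1 A2, measurable A1 -> measurable A2 ->
    P (X1 @^-1` A1 `&` X2 @^-1` A2) = P (X1 @^-1` A1) * P (X2 @^-1` A2).

Definition same_law d (E : measurableType d) (X1 X2 : Omega -> E) :=
  forall A, measurable A -> P (X1 @^-1` A) = P (X2 @^-1` A).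

Definition is_cond_expectation (G : set (set Omega)) (Y Z : Omega -> R) :=
  [/\ P.-integrable setT (EFin \o Z),
      forall B : set R, measurable B -> G (Z @^-1` B) &
      forall A, G A -> \int[P]_(w in A) (Z w)%:E = \int[P]_(w in A) (Y w)%:E].

(* A version chosen by classical choice; it exists as soon as Y is integrable
   and G is a sub-sigma-algebra, and two versions agree almost surely. *)
Definition cond_expectation (G : set (set Omega)) (Y : Omega -> R) :
    Omega -> R :=
  xget (fun=> 0%R) [set Z | is_cond_expectation G Y Z].

Definition cov (X Y : Omega -> R) : R := fine (covariance P X Y).

Definition covmx k (Y : 'I_k -> Omega -> R) : 'M[R]_k :=
  \matrix_(l, l') cov (Y l) (Y l').

(* Weak convergence, tested against bounded continuous functions. *)
Definition cvg_in_law (T : nat -> Omega -> R) (nu : probability (measurableTypeR R) R) :=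
  forall h : R -> R, continuous h -> (exists M, forall x, `|h x| <= M)%R ->
    'E_P[h \o T n] @[n --> \oo] --> \int[nu]_x (h x)%:E.

End probability.

Definition positive_definite (R : realType) k (A : 'M[R]_k) :=
  A^T = A /\ forall v : 'rV[R]_k, v != 0 -> 0 < (v *m A *m v^T) 0 0.

(* The library's normal_prob takes the standard deviation as its parameter, and
   normal_prob 0 0 is not the Dirac mass at 0. *)
Definition gaussian (R : realType) (v : R) : probability (measurableTypeR R) R :=
  if v == 0 then (\d_(0 : measurableTypeR R) : probability (measurableTypeR R) R)
  else (normal_prob 0 (Num.sqrt v) : probability (measurableTypeR R) R).

Section pick_freeze.
Context (R : realType) (dO : measure_display) (Omega : measurableType dO)
  (P : probability Omega R) (p k : nat) (d : 'I_p -> measure_display)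
  (E : forall i, measurableType (d i)).

Definition component (Y : Omega -> k.-tuple R) (l : 'I_k) (w : Omega) : R :=
  tnth (Y w) l.

Definition input (X : forall i, {RV P >-> E i}) : Omega -> product_space E :=
  fun w i => X i w.

Definition output (X : forall i, {RV P >-> E i})
    (f : {mfun product_space E >-> k.-tuple R}) : Omega -> k.-tuple R :=
  f \o input X.

Definition sobol_index (X : forall i, {RV P >-> E i})
    (f : {mfun product_space E >-> k.-tuple R}) (u : {set 'I_p}) : R :=
  let Xu : Omega -> subproduct E u := subvector u \o input X in
  let Y := component (output X f) in
  let Yu l := cond_expectation P (g_sigma_algebra_preimage Xu) (Y l) in
  \tr (covmx P Yu) / \tr (covmx P Y).

(* The sample (Y_i, Y_i^u) is indexed from 0.  When the denominator vanishes the
   quotient is 0. *)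
Definition estimator (W : nat -> Omega -> k.-tuple R * k.-tuple R) (N : nat)
    (w : Omega) : R :=
  let y i l := tnth (W i w).1 l in
  let yu i l := tnth (W i w).2 l in
  let mean l := N%:R^-1 * \sum_(i < N) ((y i l + yu i l) / 2) in
  (\sum_(l < k) (N%:R^-1 * \sum_(i < N) (y i l * yu i l) - mean l ^+ 2)) /
  (\sum_(l < k)
     (N%:R^-1 * \sum_(i < N) ((y i l ^+ 2 + yu i l ^+ 2) / 2) - mean l ^+ 2)).

End pick_freeze.

(* Main.v *)
(** Each iid sum is handled by Stein's method.  For bounded continuous [h] the
    equation [s^2 f' - x f = h - E h(N(0, s^2))] has a solution with [f] and [f']
    bounded and [f'] continuous, so it is enough to bound
    [E (W f(W)) - s^2 E f'(W)] for a normalized sum [W]; removing one summand at a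
    time, independence turns this into a Taylor remainder, which tends to [0].

    With [phi = a sum_l U_l + b sum_l V_l], which is centered with variance
    [sigma^2], and with [v = 1/a] the total variance, the error of the estimator is
    exactly [(v Z_N - (1 - S) sqrt N Q_N) / (psi_N - Q_N)], where [Z_N] is the
    normalized sum of the [phi(W_i)], [Q_N] the sum over [l] of the squared
    centered empirical means, and [psi_N] the empirical mean of
    [sum_l V_l / 2].  As [E (sqrt N Q_N) = O(N^(-1/2))] and [psi_N] tends to [v]
    in mean square, the limit is that of [Z_N].

    That [phi] is centered amounts to
    [Var (E (Y_l | X_u)) = Cov (Y_l, Y_l^u)]: integrating out [X'] in
    [f_l(x, X')] gives a version of [E (Y_l | X_u)], and conditionally on [X_u]
    the outputs [Y_l] and [Y_l^u] are independent with that same mean. *)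
Require Import Defs.
From HB Require Import structures.
From mathcomp Require Import all_boot all_order all_algebra finmap.
From mathcomp Require Import all_classical all_reals all_analysis.
From mathcomp Require Import measurable_realfun ring lra.

Import Order.TTheory GRing.Theory Num.Theory.
Import numFieldNormedType.Exports.
Local Open Scope classical_set_scope.
Local Open Scope ring_scope.

Set Implicit Arguments.
Unset Strict Implicit.
Unset Printing Implicit Defensive.

(** * Independence of disjoint blocks *)

(** The coefficients come from linearizing a quotient: at the limits of the averages of [sum_l U_l]
    and [sum_l V_l / 2], the gradient of [x / y] is [(1/v, - S/v)], which gives [a] and [b]. The
    delta method itself is avoided: translating the sample by the true means changes neither the
    numerator nor the denominator of the estimator, and the same [Q_N] is subtracted in both, so
    that a one-dimensional limit theorem is enough.

    Total functions shape many statements: division by [0] gives [0], [fine] sends an infinite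
    integral to [0], and the conditional expectation is a chosen version.

    Two degenerate cases are treated apart. Stein's equation is solved only for positive variance,
    so [sigma^2 = 0] rests on a second-moment bound. When [k = 0], positive definiteness is vacuous
    and the total variance is [0], as is the rescaled error. *)

Section dynkin_independence.
Context {R : realType} {dO : measure_display} {Omega : measurableType dO}
  (P : probability Omega R).
Local Open Scope ereal_scope.

(** With the event [A] fixed, the sets [B] that satisfy the product formula are stable under
    complement and countable disjoint union, so the formula passes from the intersection-stable
    generator [G] to the whole sigma-algebra. *)
Lemma dynkin_indep_event {d : measure_display} {T : measurableType d} (X : Omega -> T)
    (G : set (set T)) (A : set Omega) :
  measurable_fun setT X -> measurable A ->
  @measurable _ T = <<s G >> -> setI_closed G ->
  (forall B, G B -> P (X @^-1` B `&` A) = P (X @^-1` B) * P A) ->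
  forall B, measurable B -> P (X @^-1` B `&` A) = P (X @^-1` B) * P A.
Proof.
move=> mX mA GE GI GP B; rewrite GE.
have mXp S : measurable S -> measurable (X @^-1` S).
  by move=> mS; rewrite -[_ @^-1` _]setTI; exact: mX.
apply: (@dynkin_induction _ T G
  (fun B => P (X @^-1` B `&` A) = P (X @^-1` B) * P A)) => //.
- by rewrite preimage_setT setTI probability_setT mul1e.
- move=> S mS PS; rewrite -preimage_setC (setIC (~` _)) -setDE measureD//; last 2 first.
  + exact: mXp.
  + by rewrite ltey_eq fin_num_measure.
  rewrite [X in _ - X](_ : _ = P (X @^-1` S) * P A); last by rewrite setIC.
  rewrite probability_setC; last exact: mXp.
  by rewrite muleBl ?mul1e ?fin_num_measure//; exact: mXp.
- move=> F mF tF PF.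
  have tX : trivIset setT (fun n => X @^-1` F n).
    by apply/trivIsetP => i j _ _ ij; rewrite -preimage_setI;
       move/trivIsetP : tF => -> //; rewrite preimage_set0.
  have tXA : trivIset setT (fun n => X @^-1` F n `&` A).
    by apply: trivIset_setIr.
  rewrite preimage_bigcup setI_bigcupl measure_bigcup//; last first.
    by move=> n _; apply: measurableI => //; exact: mXp.
  rewrite measure_bigcup//; last by move=> n _; exact: mXp.
  rewrite muleC -(fineK (fin_num_measure P _ mA)).
  rewrite -nneseriesZl; last by move=> n _; exact: measure_ge0.
  rewrite fineK ?fin_num_measure//.
  by apply: eq_eseriesr => n _; rewrite muleC; exact: PF.
Qed.

(** The one-sided lemma is used twice: in [X1] against the event given by an arbitrary measurable
    [A2], then, for [B1] in [G1], in [X2]. *)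
Lemma independent2_generated {d1 d2 : measure_display} {T1 : measurableType d1}
    {T2 : measurableType d2} (X1 : Omega -> T1) (X2 : Omega -> T2)
    (G1 : set (set T1)) (G2 : set (set T2)) :
  measurable_fun setT X1 -> measurable_fun setT X2 ->
  @measurable _ T1 = <<s G1 >> -> setI_closed G1 ->
  @measurable _ T2 = <<s G2 >> -> setI_closed G2 ->
  (forall A1 A2, G1 A1 -> G2 A2 ->
    P (X1 @^-1` A1 `&` X2 @^-1` A2) = P (X1 @^-1` A1) * P (X2 @^-1` A2)) ->
  independent2 P X1 X2.
Proof.
move=> mX1 mX2 G1E G1I G2E G2I GP A1 A2 mA1 mA2.
have mXp d (T : measurableType d) (X : Omega -> T) S : measurable_fun setT X ->
    measurable S -> measurable (X @^-1` S).
  by move=> mX mS; rewrite -[_ @^-1` _]setTI; exact: mX.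
apply: (@dynkin_indep_event _ _ X1 G1) => //; first exact: mXp.
move=> B1 GB1; rewrite setIC muleC.
apply: (@dynkin_indep_event _ _ X2 G2) => //.
  by apply: mXp => //; rewrite G1E; exact: sub_gen_smallest.
by move=> B2 GB2; rewrite setIC muleC; exact: GP.
Qed.

End dynkin_independence.

Section product_space_theory.
Context {J : Type} {d : J -> measure_display} (E : forall i, measurableType (d i)).

Lemma measurable_coordinate (j : J) :
  measurable_fun setT (fun x : product_space E => x j).
Proof.
move=> _ B mB; apply: sub_gen_smallest; exists j => //=.
by exists B.
Qed.

Lemma measurable_to_product_space {d' : measure_display} {T : measurableType d'}
    (h : T -> product_space E) :
  (forall j, measurable_fun setT (fun t => h t j)) -> measurable_fun setT h.
Proof.
move=> mh; apply: (@measurability _ _ T (g_sigma_algebraType (@cylinder J d E)) setT h (@cylinder J d E)) => //.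
move=> _ [_ [j _ [B mB <-]] <-].
by rewrite !setTI; move: (mh j measurableT B mB); rewrite setTI.
Qed.

End product_space_theory.

Section disjoint_blocks.
Context {R : realType} {dO : measure_display} {Omega : measurableType dO}
  (P : probability Omega R) {I : choiceType} {d : I -> measure_display}
  (E : forall i, measurableType (d i)).

(** For [q := fun i => i \in u] this is convertible to [subproduct E u], so independence of blocks
    applies directly to the inputs; with [I := nat] it also serves the samples. *)
Definition block (q : pred I) :=
  product_space (fun j : {i : I | q i} => E (sval j)).

Definition block_map (q : pred I) (X : forall i, Omega -> E i) :
  Omega -> block q := fun w j => X (sval j) w.

Arguments block_map q X : clear implicits.

Lemma measurable_block_map (X : forall i, Omega -> E i) (q : pred I) :
  (forall i, measurable_fun setT (X i)) -> measurable_fun setT (block_map q X).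
Proof. by move=> mX; apply: measurable_to_product_space => j; exact: mX. Qed.

(** [A] is a family over all of [I] rather than over the block: this is the shape that
    [mutually_independent] expects, and two rectangles intersect by intersecting their families. The
    support [K] is finite because independence speaks of finite index sets while [I] may be
    infinite. *)
Definition rectangle (q : pred I) : set (set (block q)) :=
  [set C | exists (K : {fset I}) (A : forall i, set (E i)),
    [/\ forall i, measurable (A i), forall i, i \notin K -> A i = setT &
        C = [set x | forall j, A (sval j) (x j)]]].

Arguments rectangle q : clear implicits.

Lemma rectangle_setI_closed (q : pred I) : setI_closed (rectangle q).
Proof.
move=> _ _ [K [A [mA AK ->]]] [K' [A' [mA' AK' ->]]].
exists (K `|` K')%fset, (fun i => A i `&` A' i); split.
- by move=> i; exact: measurableI.
- by move=> i; rewrite inE negb_or => /andP[iK iK']; rewrite AK// AK'// setTI.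
- apply/seteqP; split=> x /=; first by move=> [H H'] j.
  by move=> H; split=> j; case: (H j).
Qed.

Lemma measurable_blockE (q : pred I) :
  @measurable _ (block q) = <<s rectangle q >>.
Proof.
apply/seteqP; split.
  apply: smallest_sub; first exact: smallest_sigma_algebra.
  move=> _ [j _ [B mB <-]]; apply: sub_gen_smallest.
  exists [fset sval j]%fset, (dfwith (fun i => setT : set (E i)) (sval j) B); split.
  - by move=> i; case: dfwithP.
  - by move=> i; rewrite inE eq_sym => ji; rewrite dfwithout.
  - rewrite setTI; apply/seteqP; split=> x /=; last first.
      by move=> /(_ j); rewrite dfwithin.
    move=> Bx j'; have [jj'|jj'] := eqVneq (sval j) (sval j').
      have jE : j = j' by exact: val_inj.
      by rewrite -jE dfwithin.
    by rewrite dfwithout.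
apply: smallest_sub; first exact: sigma_algebra_measurable.
move=> _ [K [A [mA AK ->]]].
have -> : [set x : block q | forall j, A (sval j) (x j)] =
    \bigcap_(i in [set` K]) [set x : block q | forall j, sval j = i -> A (sval j) (x j)].
  apply/seteqP; split=> x /= H.
    by move=> i iK j ji; exact: H.
  move=> j; have [jK|jK] := boolP (sval j \in K); first exact: (H _ jK).
  by rewrite AK.
apply: fin_bigcap_measurable; first exact: finite_fset.
(* An index of [K] outside the block imposes no condition, hence the full set. *)
move=> i _; have [qi|qi] := boolP (q i); last first.
  rewrite [X in measurable X](_ : _ = setT)//; apply/seteqP; split=> // x _ j ji.
  by exfalso; move: qi; rewrite -ji (svalP j).
rewrite [X in measurable X](_ : _ = (fun x : block q => x (exist _ i qi)) @^-1` A i).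
  by rewrite -[X in measurable X]setTI; apply: measurable_coordinate.
apply/seteqP; split=> x /=; first by move=> /(_ (exist _ i qi)) /(_ erefl).
by move=> H j ji; have -> : j = exist _ i qi by exact: val_inj.
Qed.

(** Preimages of rectangles are finite intersections over a common index set. After padding with
    [setT] outside each block ([B] below), every index carries at most one proper condition because
    the blocks are disjoint, so the product over the indices splits factor by factor. *)
Lemma mutually_independent_blocks (X : forall i, Omega -> E i) (q1 q2 : pred I) :
  (forall i, measurable_fun setT (X i)) -> (forall i, q1 i -> ~~ q2 i) ->
  mutually_independent P X ->
  independent2 P (block_map q1 X) (block_map q2 X).
Proof.
move=> mX q12 iX.
apply: (@independent2_generated _ _ _ P _ _ _ _ _ _ (rectangle q1) (rectangle q2)).
- exact: measurable_block_map.
- exact: measurable_block_map.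
- exact: measurable_blockE.
- exact: rectangle_setI_closed.
- exact: measurable_blockE.
- exact: rectangle_setI_closed.
move=> _ _ [K1 [A1 [mA1 AK1 ->]]] [K2 [A2 [mA2 AK2 ->]]].
pose K := (K1 `|` K2)%fset.
pose B q (A : forall i, set (E i)) i : set (E i) := if q i then A i else setT.
have mB q A : (forall i, measurable (A i)) -> forall i, measurable (B q A i).
  by move=> mA i; rewrite /B; case: ifP.
have BE q A : (forall i, i \notin K -> A i = setT) ->
    block_map q X @^-1` [set x | forall j, A (sval j) (x j)] =
    \bigcap_(i in [set` K]) (X i @^-1` B q A i).
  move=> AK; apply/seteqP; split=> w /= H.
    move=> i iK /=; rewrite /B; case: ifPn => // qi.
    exact: (H (exist _ i qi)).
  move=> [i qi] /=; have [iK|iK] := boolP (i \in K); last by rewrite AK.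
  by have := H _ iK; rewrite /B /= qi.
have AK1' i : i \notin K -> A1 i = setT.
  by rewrite inE negb_or => /andP[/AK1].
have AK2' i : i \notin K -> A2 i = setT.
  by rewrite inE negb_or => /andP[_ /AK2].
rewrite !BE// -bigcapI.
rewrite (_ : \bigcap_(i in _) _ =
    \bigcap_(i in [set` K]) (X i @^-1` (B q1 A1 i `&` B q2 A2 i)))//.
rewrite !iX//; last 3 first.
- by move=> i _; exact: mB.
- by move=> i _; exact: mB.
- by move=> i _; apply: measurableI; exact: mB.
rewrite -big_split/=; apply: eq_bigr => i _.
rewrite /B; case: ifPn => q1i.
  by rewrite (negbTE (q12 _ q1i)) setIT preimage_setT probability_setT mule1.
by rewrite setTI preimage_setT probability_setT mul1e.
Qed.

End disjoint_blocks.
Arguments block_map {dO Omega I d E} q X.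

(** * Integrating out an independent variable *)

Section laws.
Context {R : realType} {dO : measure_display} {Omega : measurableType dO}
  (P : probability Omega R).
Local Open Scope ereal_scope.

Lemma same_law_integral {d : measure_display} {T : measurableType d}
    (X1 X2 : Omega -> T) (g : T -> R) :
  measurable_fun setT X1 -> measurable_fun setT X2 -> measurable_fun setT g ->
  same_law P X1 X2 -> P.-integrable setT (EFin \o (g \o X1)) ->
  P.-integrable setT (EFin \o (g \o X2)) /\
  (\int[P]_w g (X1 w) = \int[P]_w g (X2 w))%R.
Proof.
move=> mX1 mX2 mg X12 ig.
pose Y1 : {mfun Omega >-> T} := HB.pack X1 (isMeasurableFun.Build _ _ _ _ _ mX1).
pose Y2 : {mfun Omega >-> T} := HB.pack X2 (isMeasurableFun.Build _ _ _ _ _ mX2).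
have mEg : measurable_fun setT (fun y => (g y)%:E) by exact/measurable_EFinP.
have ig2 : P.-integrable setT (EFin \o (g \o X2)).
  apply/integrableP; split; first by apply/measurable_EFinP; exact: measurableT_comp.
  have /integrableP[_] := ig; apply: le_lt_trans.
  have m1 : measurable_fun setT (fun y => `|(g y)%:E|) by exact: measurableT_comp.
  have -> : \int[P]_x `|(EFin \o (g \o X2)) x| =
      \int[distribution P Y2]_y `|(g y)%:E|.
    by rewrite ge0_integral_distribution.
  have -> : \int[P]_x `|(EFin \o (g \o X1)) x| =
      \int[distribution P Y1]_y `|(g y)%:E|.
    by rewrite ge0_integral_distribution.
  rewrite le_eqVlt; apply/orP; left; apply/eqP; apply: eq_measure_integral => A mA _.
  exact/esym/X12.
split=> //; congr fine.
transitivity (\int[distribution P Y1]_y (g y)%:E).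
  by rewrite (integral_distribution mEg).
transitivity (\int[distribution P Y2]_y (g y)%:E).
  by apply: eq_measure_integral => A mA _; exact: X12.
by rewrite (integral_distribution mEg).
Qed.

Lemma independent2_comp {d1 d2 d3 d4 : measure_display} {T1 : measurableType d1}
    {T2 : measurableType d2} {T3 : measurableType d3} {T4 : measurableType d4}
    (X1 : Omega -> T1) (X2 : Omega -> T2) (g1 : T1 -> T3) (g2 : T2 -> T4) :
  measurable_fun setT g1 -> measurable_fun setT g2 ->
  independent2 P X1 X2 -> independent2 P (g1 \o X1) (g2 \o X2).
Proof.
move=> mg1 mg2 iX A1 A2 mA1 mA2.
by rewrite 2!comp_preimage iX// -[X in measurable X]setTI; [exact: mg1|exact: mg2].
Qed.

Section freezing.
Context {d1 d2 : measure_display} {T1 : measurableType d1}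
  {T2 : measurableType d2} (X1 : Omega -> T1) (X2 : Omega -> T2).
Hypotheses (mX1 : measurable_fun setT X1) (mX2 : measurable_fun setT X2)
  (iX : independent2 P X1 X2).

Let Y1 : {mfun Omega >-> T1} := HB.pack X1 (isMeasurableFun.Build _ _ _ _ _ mX1).
Let Y2 : {mfun Omega >-> T2} := HB.pack X2 (isMeasurableFun.Build _ _ _ _ _ mX2).
Let m1 := distribution P Y1.

Let mjoint : measurable_fun setT (fun w => (X1 w, X2 w)).
Proof. exact: measurable_fun_pair. Qed.
Let joint : {mfun Omega >-> (T1 * T2)%type} :=
  HB.pack (fun w => (X1 w, X2 w)) (isMeasurableFun.Build _ _ _ _ _ mjoint).

Let mfrozen : measurable_fun setT (fun z : T1 * Omega => (z.1, X2 z.2)).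
Proof. by apply: measurable_fun_pair => //; exact: measurableT_comp. Qed.
Let frozen : {mfun (T1 * Omega)%type >-> (T1 * T2)%type} :=
  HB.pack (fun z : T1 * Omega => (z.1, X2 z.2))
    (isMeasurableFun.Build _ _ _ _ _ mfrozen).

(** Independence makes the joint law the product of the two laws. On the left the second factor is
    kept on [Omega] with [P], so that the inner integral of Fubini's theorem is the one in
    [frozen_mean]. *)
Let joint_law A : measurable A ->
  pushforward (m1 \x P) frozen A = pushforward P joint A.
Proof.
move=> mA.
by rewrite -(@product_measure_unique _ _ _ _ _ m1 (distribution P Y2)
  (pushforward P joint)).
Qed.

Variable F : T1 * T2 -> R.
Hypotheses (mF : measurable_fun setT F)
  (iF : P.-integrable setT (fun w => (F (X1 w, X2 w))%:E)).

Definition frozen_mean (x : T1) : R := (\int[P]_w F (x, X2 w))%R.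

Let f (z : T1 * Omega) : \bar R := (F (z.1, X2 z.2))%:E.
Let mEF : measurable_fun setT (fun y => (F y)%:E). Proof. exact/measurable_EFinP. Qed.

Let integrable_f : (m1 \x P).-integrable setT f.
Proof.
apply/integrableP; split.
  by apply/measurable_EFinP; exact: (measurableT_comp mF mfrozen).
have /integrableP[_] := iF; apply: le_lt_trans.
have mabs : measurable_fun setT (fun y => `|(F y)%:E|) by exact: measurableT_comp.
have -> : \int[m1 \x P]_z `|f z| = \int[pushforward (m1 \x P) frozen]_y `|(F y)%:E|.
  by rewrite ge0_integral_pushforward.
have -> : \int[P]_w `|(F (X1 w, X2 w))%:E| = \int[pushforward P joint]_y `|(F y)%:E|.
  by rewrite ge0_integral_pushforward.
rewrite le_eqVlt; apply/orP; left; apply/eqP; apply: eq_measure_integral => A mA _.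
exact: joint_law.
Qed.

Let integral_f : \int[m1 \x P]_z f z = \int[P]_w (F (X1 w, X2 w))%:E.
Proof.
transitivity (\int[pushforward (m1 \x P) frozen]_y (F y)%:E).
  by rewrite integral_pushforward//; exact: measurable_funP.
transitivity (\int[pushforward P joint]_y (F y)%:E); last first.
  by rewrite integral_pushforward//; exact: measurable_funP.
by apply: eq_measure_integral => A mA _; exact: joint_law.
Qed.

Let frozen_meanE x : frozen_mean x = fine (fubini_F P f x).
Proof. by []. Qed.

Lemma measurable_frozen_mean : measurable_fun setT frozen_mean.
Proof.
apply: (@measurableT_comp _ _ _ _ _ _ fine) => //.
exact: (measurable_fubini_F integrable_f).
Qed.

(** Only almost everywhere: on a null set of [x] the inner integral may be infinite, and
    [frozen_mean] is then [0]. *)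
Let ae_frozen : ae_eq m1 setT (EFin \o frozen_mean) (fubini_F P f).
Proof.
have := integrable_ae measurableT (integrable_fubini_F integrable_f).
by apply: filterS => x /= fx Dx; rewrite frozen_meanE fineK// fx.
Qed.

Let integrable_frozen_mean1 : m1.-integrable setT (EFin \o frozen_mean).
Proof.
have mfm : measurable_fun setT (fun y => (frozen_mean y)%:E).
  by apply/measurable_EFinP; exact: measurable_frozen_mean.
apply: (le_integrable measurableT mfm _ (integrable_fubini_F integrable_f)).
by move=> x _; rewrite /= frozen_meanE; case: (fubini_F P f x) => [r||] //=; rewrite normr0 leey.
Qed.

Lemma integrable_frozen_mean :
  P.-integrable setT (EFin \o (frozen_mean \o X1)).
Proof.
have mfm : measurable_fun setT (fun y => (frozen_mean y)%:E).
  by apply/measurable_EFinP; exact: measurable_frozen_mean.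
apply/integrableP; split.
  by apply/measurable_EFinP; exact: (measurableT_comp measurable_frozen_mean).
have /integrableP[_] := integrable_frozen_mean1.
by rewrite ge0_integral_distribution//; exact: measurableT_comp.
Qed.

Lemma integral_frozen_mean :
  (\int[P]_w F (X1 w, X2 w) = \int[P]_w frozen_mean (X1 w))%R.
Proof.
congr fine; rewrite -integral_f -(integral12_prod_meas1 integrable_f).
have mfm : measurable_fun setT (fun y => (frozen_mean y)%:E).
  by apply/measurable_EFinP; exact: measurable_frozen_mean.
transitivity (\int[m1]_x (frozen_mean x)%:E); last first.
  by rewrite (integral_distribution mfm)//; exact: integrable_frozen_mean.
apply: ae_eq_integral => //; first exact: (measurable_fubini_F integrable_f).
exact: ae_eq_sym ae_frozen.
Qed.

End freezing.

(** Freezing the first factor at [x] leaves the mean of [x * Y], which is [x] times the mean of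
    [Y]. *)
Lemma independent2_integralM (X Y : Omega -> R) :
  independent2 P X Y ->
  P.-integrable setT (EFin \o X) -> P.-integrable setT (EFin \o Y) ->
  P.-integrable setT (EFin \o (fun w => X w * Y w)%R) ->
  (\int[P]_w (X w * Y w) = (\int[P]_w X w) * (\int[P]_w Y w))%R.
Proof.
move=> iXY iX iY iM.
have mX : measurable_fun setT X by exact/measurable_EFinP/(measurable_int _ iX).
have mY : measurable_fun setT Y by exact/measurable_EFinP/(measurable_int _ iY).
have mF : measurable_fun setT (fun z : R * R => z.1 * z.2)%R.
  exact: measurable_funM.
rewrite (integral_frozen_mean mX mY iXY mF iM).
rewrite -RintegralZr//; apply: eq_Rintegral => w _.
by rewrite /frozen_mean RintegralZl.
Qed.

End laws.

(** * Expectations of real random variables *)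

Section expectation_calculus.
Context {R : realType} {dO : measure_display} {Omega : measurableType dO}
  (P : probability Omega R).
Implicit Types X Y : Omega -> R.

Definition L1 X := P.-integrable setT (fun w => (X w)%:E).
Definition L2 X := measurable_fun setT X /\ L1 (fun w => X w ^+ 2).
Definition Ex X : R := \int[P]_w X w.

Lemma Ex_expectation X : fine 'E_P[X]%E = Ex X.
Proof. by rewrite unlock. Qed.

Lemma expectation_Ex X : L1 X -> 'E_P[X]%E = (Ex X)%:E.
Proof.
by move=> iX; rewrite unlock fineK//; exact: (integrable_fin_num measurableT iX).
Qed.

Lemma measurable_L1 X : L1 X -> measurable_fun setT X.
Proof. by move=> iX; exact/measurable_EFinP/(measurable_int _ iX). Qed.

Lemma L1_le X Y : measurable_fun setT X -> (forall w, `|X w| <= Y w) ->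
  L1 Y -> L1 X.
Proof.
move=> mX XY iY; apply: (le_integrable measurableT _ _ iY).
  exact/measurable_EFinP.
by move=> w _; rewrite lee_fin (le_trans (XY w))// ler_norm.
Qed.

Lemma L1_cst (c : R) : L1 (fun=> c).
Proof.
exact: finite_measure_integrable_cst.
Qed.

Lemma L1_bounded X (M : R) : measurable_fun setT X -> (forall w, `|X w| <= M) ->
  L1 X.
Proof. by move=> mX XM; apply: (L1_le mX XM); exact: L1_cst. Qed.

Lemma L1D X Y : L1 X -> L1 Y -> L1 (fun w => X w + Y w).
Proof. by move=> iX iY; exact: (integrableD measurableT iX iY). Qed.

Lemma L1B X Y : L1 X -> L1 Y -> L1 (fun w => X w - Y w).
Proof. by move=> iX iY; exact: (integrableB measurableT iX iY). Qed.

Lemma L1Z (c : R) X : L1 X -> L1 (fun w => c * X w).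
Proof. by move=> iX; exact: (integrableZl measurableT c iX). Qed.

Lemma L1_sum (I : Type) (r : seq I) (X : I -> Omega -> R) :
  (forall i, L1 (X i)) -> L1 (fun w => \sum_(i <- r) X i w).
Proof.
move=> iX; elim: r => [|i r IH].
  by under eq_fun do rewrite big_nil; exact: L1_cst.
by under eq_fun do rewrite big_cons; exact: L1D.
Qed.

Lemma L1_norm X : L1 X -> L1 (fun w => `|X w|).
Proof.
move=> iX; have := integrable_abse iX; rewrite /L1.
by apply: eq_integrable.
Qed.

Lemma L1M_bounded X Y (M : R) : L1 X -> measurable_fun setT Y ->
  (forall w, `|Y w| <= M) -> L1 (fun w => X w * Y w).
Proof.
move=> iX mY YM; apply: (@L1_le _ (fun w => M * `|X w|)).
- by apply: measurable_funM => //; exact: measurable_L1.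
- by move=> w; rewrite normrM mulrC ler_wpM2r.
- by apply: L1Z; exact: L1_norm.
Qed.

Lemma Ex_cst (c : R) : Ex (fun=> c) = c.
Proof.
rewrite /Ex Rintegral_cst// (_ : fine _ = 1) ?mulr1//.
by rewrite -[RHS]/(fine 1%E) -(probability_setT P).
Qed.

Lemma ExD X Y : L1 X -> L1 Y -> Ex (fun w => X w + Y w) = Ex X + Ex Y.
Proof. by move=> iX iY; exact: RintegralD. Qed.

Lemma ExB X Y : L1 X -> L1 Y -> Ex (fun w => X w - Y w) = Ex X - Ex Y.
Proof. by move=> iX iY; exact: RintegralB. Qed.

Lemma ExZ (c : R) X : L1 X -> Ex (fun w => c * X w) = c * Ex X.
Proof. by move=> iX; exact: RintegralZl. Qed.

Lemma Ex_sum (I : Type) (r : seq I) (X : I -> Omega -> R) :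
  (forall i, L1 (X i)) ->
  Ex (fun w => \sum_(i <- r) X i w) = \sum_(i <- r) Ex (X i).
Proof.
move=> iX; elim: r => [|i r IH].
  by under eq_fun do rewrite big_nil; rewrite Ex_cst big_nil.
under eq_fun do rewrite big_cons.
by rewrite ExD// ?IH ?big_cons//; exact: L1_sum.
Qed.

Lemma Ex_le X Y : L1 X -> L1 Y -> (forall w, X w <= Y w) -> Ex X <= Ex Y.
Proof. by move=> iX iY XY; apply: le_Rintegral. Qed.

Lemma Ex_ge0 X : (forall w, 0 <= X w) -> 0 <= Ex X.
Proof. by move=> X0; apply: Rintegral_ge0. Qed.

Lemma Ex_norm_le X Y : measurable_fun setT X -> L1 Y ->
  (forall w, `|X w| <= Y w) -> `|Ex X| <= Ex Y.
Proof.
move=> mX iY XY; have iX := L1_le mX XY iY.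
by apply: (le_trans (le_normr_Rintegral measurableT iX)); apply: Ex_le => //; exact: L1_norm.
Qed.

Lemma L2_L1 X : L2 X -> L1 X.
Proof.
move=> [mX iX]; apply: (@L1_le _ (fun w => 1 + X w ^+ 2)) => //.
  by move=> w; rewrite -(real_normK (num_real (X w))); nra.
by apply: L1D => //; exact: L1_cst.
Qed.

Lemma L2M X Y : L2 X -> L2 Y -> L1 (fun w => X w * Y w).
Proof.
move=> [mX iX] [mY iY]; apply: (@L1_le _ (fun w => X w ^+ 2 + Y w ^+ 2)) => //.
- exact: measurable_funM.
- move=> w; rewrite normrM -(real_normK (num_real (X w))).
  by rewrite -(real_normK (num_real (Y w))); nra.
- exact: L1D.
Qed.

Lemma L2_cst (c : R) : L2 (fun=> c).
Proof. by split => //; exact: L1_cst. Qed.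

Lemma L2D X Y : L2 X -> L2 Y -> L2 (fun w => X w + Y w).
Proof.
move=> X2 Y2; have [mX iX] := X2; have [mY iY] := Y2; split.
  exact: measurable_funD.
under eq_fun do rewrite sqrrD.
apply: L1D => //; apply: L1D => //.
under eq_fun do rewrite -mulr_natl.
by apply: L1Z; exact: L2M.
Qed.

Lemma L2Z (c : R) X : L2 X -> L2 (fun w => c * X w).
Proof.
move=> [mX iX]; split; first exact: measurable_funM.
by under eq_fun do rewrite exprMn; exact: L1Z.
Qed.

Lemma L2B X Y : L2 X -> L2 Y -> L2 (fun w => X w - Y w).
Proof.
move=> X2 Y2; have := L2D X2 (L2Z (-1) Y2).
by under eq_fun do rewrite mulN1r.
Qed.

Lemma L2_sum (I : Type) (r : seq I) (X : I -> Omega -> R) :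
  (forall i, L2 (X i)) -> L2 (fun w => \sum_(i <- r) X i w).
Proof.
move=> iX; elim: r => [|i r IH].
  by under eq_fun do rewrite big_nil; exact: L2_cst.
by under eq_fun do rewrite big_cons; exact: L2D.
Qed.

Lemma covE X Y : cov P X Y = Ex (fun w => (X w - Ex X) * (Y w - Ex Y)).
Proof. by rewrite /cov unlock Ex_expectation !Ex_expectation. Qed.

End expectation_calculus.

(** * Stein's equation *)

Section stein_equation.
Context {R : realType}.
Variable s : R.
Hypothesis s0 : 0 < s.
Notation mu := (@lebesgue_measure R).
Local Notation p := (normal_pdf 0 s).

Let s_neq0 : s != 0. Proof. by rewrite gt_eqF. Qed.

Lemma normal_pdf_gt0 x : 0 < p x.
Proof. by rewrite normal_pdfE// mulr_gt0 ?expR_gt0// normal_peak_gt0. Qed.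

Lemma is_derive_normal_pdf (x : R) :
  is_derive x 1 p (- (x / s ^+ 2) * p x).
Proof.
pose g : R -> R := (- (s ^+ 2 *+ 2)^-1) *: (@id R ^+ 2).
have pE : p = normal_peak s *: (expR \o g).
  apply/funext => y; rewrite normal_pdfE// /normal_fun subr0 /g /=.
  by congr (_ * expR _); rewrite mulNr mulrC -mulNr.
have dg : is_derive x 1 g (- (s ^+ 2 *+ 2)^-1 * (2 * x)).
  by apply: is_derive_eq; rewrite /GRing.scale/= mulr1 expr1 mulr_natl.
have dp := is_derive1_comp (is_derive_expR (g x)) dg.
rewrite {1}pE; apply: is_derive_eq.
rewrite pE /GRing.scale/= -[X in _ = _ * X]/(normal_peak s * expR (g x)) -(mulr_natr _ 2).
move: (expR _) (normal_peak s) => e c; field.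
by rewrite s_neq0.
Qed.

Lemma normal_pdf_even x : p (- x) = p x.
Proof. by rewrite normal_pdfE// /normal_fun !subr0 sqrrN. Qed.

Lemma cvg_normal_pdfy : p x @[x --> +oo] --> (0 : R).
Proof.
have -> : p = (fun x => normal_peak s * expR (- (x ^+ 2 / (s ^+ 2 *+ 2)))).
  by apply/funext => x; rewrite normal_pdfE// /normal_fun subr0 mulNr.
rewrite -(mulr0 (normal_peak s)); apply: cvgMr.
apply: (@cvg_comp _ _ _ (fun x : R => x ^+ 2 / (s ^+ 2 *+ 2)) (fun y => expR (- y)) _ +oo).
  apply: gt0_cvgMly; last exact: cvgr_expr2.
  by rewrite invr_gt0 pmulrn_lgt0// exprn_gt0.
exact: cvgr_expR.
Qed.

(* On [[x, +oo[], [p t <= t / x * p t], and the right-hand side has the primitive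
   [- s^2 / x * p t]. *)
Lemma normal_tail (x : R) : 0 < x ->
  \int[mu]_(t in `[x, +oo[) p t <= s ^+ 2 * p x / x.
Proof.
move=> x0.
pose F (t : R) : R := - (s ^+ 2 / x) * p t.
have dF (t : R) : is_derive t 1 F (t / x * p t).
  have h := is_derive_normal_pdf t.
  apply: is_derive_eq; rewrite /GRing.scale/=; field.
  by rewrite s_neq0 gt_eqF.
have cp : continuous p by exact: continuous_normal_pdf.
have ctp : continuous (fun t : R => t / x * p t : R).
  move=> t; apply: cvgM; last exact: cp.
  by apply: cvgM; [exact: cvg_id|exact: cvg_cst].
have H : (\int[mu]_(t in `[x, +oo[) (t / x * p t)%:E = 0%:E - (F x)%:E)%E.
  apply: (@ge0_continuous_FTC2y R (fun t => t / x * p t) F x 0).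
  - by move=> t xt; rewrite mulr_ge0 ?normal_pdf_ge0// divr_ge0 ?(ltW x0)// (le_trans (ltW x0)).
  - exact: continuous_subspaceT.
  - by rewrite -(mulr0 (- (s ^+ 2 / x))); apply: cvgMr; exact: cvg_normal_pdfy.
  - by move=> t _; case: (dF t).
  - apply: cvg_at_right_filter.
    by apply: differentiable_continuous; apply/derivable1_diffP; case: (dF x).
  - by move=> t _; rewrite derive1E; exact: derive_val.
have -> : s ^+ 2 * p x / x = fine (\int[mu]_(t in `[x, +oo[) (t / x * p t)%:E).
  by rewrite H /= /F; field; rewrite gt_eqF.
have ip : mu.-integrable `[x, +oo[ (EFin \o p).
  by apply: (integrableS measurableT) => //; exact: integrable_normal_pdf.
apply: fine_le.
- exact: integrable_fin_num ip.
- by rewrite H.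
- apply: ge0_le_integral => //=.
  + by move=> t _; rewrite lee_fin normal_pdf_ge0.
  + by apply: measurable_funTS; apply/measurable_EFinP; exact: measurable_normal_pdf.
  + apply: measurable_funTS; apply/measurable_EFinP.
    exact: continuous_measurable_fun.
  + move=> t; rewrite in_itv/= andbT => xt; rewrite lee_fin.
    by rewrite ler_peMl ?normal_pdf_ge0// ler_pdivlMr// mul1r.
Qed.

Lemma normal_tailN (x : R) : 0 < x ->
  \int[mu]_(t in `]-oo, (- x)]) p t <= s ^+ 2 * p x / x.
Proof.
move=> x0; apply: le_trans (normal_tail x0).
rewrite /Rintegral ge0_integration_by_substitutionNy.
- rewrite le_eqVlt; apply/orP; left; apply/eqP; congr fine.
  by apply: eq_integral => t _ /=; congr EFin; exact: normal_pdf_even.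
- by apply: continuous_subspaceT; exact: continuous_normal_pdf.
- by move=> t _; exact: normal_pdf_ge0.
Qed.

(** [p] and the Radon-Nikodym derivative of the normal law have the same integral over every
    measurable set, hence agree almost everywhere; the change of variables then turns the Gaussian
    expectation into a Lebesgue integral. *)
Lemma integral_normal_prob (h : R -> R) (M : R) :
  measurable_fun setT h -> (forall x, `|h x| <= M) ->
  (\int[normal_prob 0 s]_x (h x)%:E = \int[mu]_x (h x * p x)%:E)%E.
Proof.
move=> mh hM.
pose nu : probability (measurableTypeR R) R := normal_prob 0 s.
have dom : nu `<< mu by exact: normal_prob_dominates.
have ih : nu.-integrable setT (EFin \o h).
  apply: (le_integrable measurableT _ _ (finite_measure_integrable_cst nu M measurableT)).
    exact/measurable_EFinP.
  by move=> x _; rewrite lee_fin (le_trans (hM x))// ler_norm.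
rewrite -(Radon_Nikodym_change_of_variables dom measurableT ih).
have irn : mu.-integrable setT (Radon_Nikodym (charge_of_finite_measure nu) mu).
  exact: Radon_Nikodym_integrable.
apply: ae_eq_integral => //.
- apply: emeasurable_funM; first exact/measurable_EFinP.
  exact: measurable_int irn.
- apply/measurable_EFinP/measurable_funM => //; exact: measurable_normal_pdf.
have H : ae_eq mu setT (Radon_Nikodym (charge_of_finite_measure nu) mu) (EFin \o p).
  apply: (integral_ae_eq measurableT irn).
    by apply/measurable_EFinP; exact: measurable_normal_pdf.
  by move=> A _ mA; rewrite -Radon_Nikodym_integral.
by apply: filterS H => x + _ => /(_ I) /= ->.
Qed.

(** * Bounded solution of Stein's equation *)

Section solution.
Variables (h : R -> R) (M : R).
Hypotheses (ch : continuous h) (hM : forall x, `|h x| <= M).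

Let c := fine (\int[normal_prob 0 s]_x (h x)%:E)%E.
Let g (t : R) : R := (h t - c) * p t.
Let G (x : R) : R := \int[mu]_(t in `]-oo, x]) g t.

Let M0 : 0 <= M. Proof. exact: le_trans (hM 0). Qed.

Let mh : measurable_fun setT h. Proof. exact: continuous_measurable_fun. Qed.

Let ip : mu.-integrable setT (EFin \o p). Proof. exact: integrable_normal_pdf. Qed.

Let ihp : mu.-integrable setT (fun t => (h t * p t)%:E).
Proof.
apply: (le_integrable measurableT _ _ (integrableZl measurableT M ip)).
  by apply/measurable_EFinP/measurable_funM => //; exact: measurable_normal_pdf.
move=> t _; rewrite lee_fin normrM normrM ler_wpM2r//.
by rewrite (le_trans (hM t))// ler_norm.
Qed.

Let igp : mu.-integrable setT (EFin \o g).
Proof.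
have := integrableB measurableT ihp (integrableZl measurableT c ip).
by apply: eq_integrable => // t _; rewrite /g /= mulrBl EFinB (EFinM c).
Qed.

Let cE : c = \int[mu]_t (h t * p t).
Proof. by rewrite /c (integral_normal_prob mh hM). Qed.

Let p1 : \int[mu]_t p t = 1.
Proof. by rewrite /Rintegral integral_normal_pdf. Qed.

Let cM : `|c| <= M.
Proof.
rewrite cE; apply: (le_trans (le_normr_Rintegral measurableT ihp)).
rewrite -[leRHS]mulr1 -p1 -RintegralZl//.
apply: le_Rintegral => //.
- exact: (integrable_abse ihp).
- exact: (integrableZl measurableT M ip).
- by move=> t _; rewrite normrM (ger0_norm (normal_pdf_ge0 _ _ _)) ler_wpM2r ?normal_pdf_ge0.
Qed.

Let total : \int[mu]_t g t = 0.
Proof.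
rewrite /g; under eq_Rintegral do rewrite mulrBl.
rewrite RintegralB//; last exact: (integrableZl measurableT c ip).
by rewrite RintegralZl// p1 mulr1 -cE subrr.
Qed.

Let g_le t : `|g t| <= 2 * M * p t.
Proof.
rewrite normrM (ger0_norm (normal_pdf_ge0 _ _ _)) ler_wpM2r ?normal_pdf_ge0//.
by rewrite (le_trans (ler_normB _ _))// mulr_natl mulr2n lerD.
Qed.

Let G_le (A : set (measurableTypeR R)) : measurable A ->
  `|\int[mu]_(t in A) g t| <= 2 * M * \int[mu]_(t in A) p t.
Proof.
move=> mA.
have iA : mu.-integrable A (EFin \o g) by exact: integrableS igp.
have iAp : mu.-integrable A (EFin \o p) by exact: integrableS ip.
apply: (le_trans (le_normr_Rintegral mA iA)).
rewrite -RintegralZl//; apply: le_Rintegral => //.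
- exact: (integrable_abse iA).
- exact: (integrableZl mA _ iAp).
Qed.

(** For [x < 0], [G x] is a left tail of [g]. For [x > 0] the vanishing total integral turns it into
    minus a right tail. In both cases [|g| <= 2 M p] and the Gaussian tail bound conclude. *)
Let G_tail x : `|x * G x| <= 2 * M * s ^+ 2 * p x.
Proof.
have [x0|x0|->] := ltgtP x 0; last first.
- rewrite mul0r normr0; apply: mulr_ge0; last exact: normal_pdf_ge0.
  by apply: mulr_ge0; [exact: mulr_ge0|exact: sqr_ge0].
- have -> : G x = - \int[mu]_(t in `[x, +oo[) g t.
    rewrite -Rintegral_itv_obnd_cbnd; last by exact: integrableS igp.
    have iT : mu.-integrable [set` Interval -oo%O +oo%O] (EFin \o g) by rewrite set_itvE.
    have <- := @Rintegral_itvB R g -oo%O +oo%O x iT isT isT.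
    by rewrite set_itvE total sub0r opprK.
  rewrite normrM normrN (gtr0_norm x0) mulrC -ler_pdivlMr//.
  apply: (le_trans (G_le _)) => //.
  rewrite [leRHS](_ : _ = 2 * M * (s ^+ 2 * p x / x)); last by rewrite !mulrA.
  by rewrite ler_wpM2l ?mulr_ge0//; exact: normal_tail.
- rewrite normrM (ltr0_norm x0) mulrC -ler_pdivlMr ?oppr_gt0//.
  apply: (le_trans (G_le _)) => //.
  rewrite [leRHS](_ : _ = 2 * M * (s ^+ 2 * p x / - x)); last by rewrite !mulrA.
  rewrite ler_wpM2l ?mulr_ge0//.
  have x0' : 0 < - x by rewrite oppr_gt0.
  by have := normal_tailN x0'; rewrite opprK normal_pdf_even.
Qed.

Let is_derive_G (x : R) : is_derive x 1 G (g x).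
Proof.
have cg : {for x, continuous g}.
  apply: cvgM; last exact: continuous_normal_pdf.
  by apply: cvgB; [exact: ch|exact: cvg_cst].
have ix : mu.-integrable `]-oo, (x + 1)%R] (EFin \o g) by exact: integrableS igp.
have x1 : x < x + 1 by rewrite ltrDl.
have [dG <-] := continuous_FTC1 x1 ix (ltNyr x) cg.
by rewrite derive1E; exact/derivableP.
Qed.

(** [f'] is defined by solving the equation for it, so the equation holds at once, continuity of
    [f'] follows from that of [f], and a bound on [x * f x] is enough to bound [f']. That bound,
    [2 M], is [G_tail] divided by [s^2 p x]. *)
Lemma stein_solution : exists f f' : R -> R,
  [/\ forall x : R, is_derive x 1 f (f' x), continuous f',
      exists L, forall x, `|f x| <= L /\ `|f' x| <= L &
      forall x, s ^+ 2 * f' x - x * f x = h x - c].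
Proof.
have p_gt0 x := normal_pdf_gt0 x.
(* [G] is a primitive of [(h - c) p] vanishing at both ends, and
   [p' x = - x / s^2 * p x]. *)
pose f (x : R) : R := s ^- 2 * (G x * (p x)^-1).
pose f' (x : R) : R := s ^- 2 * (h x - c + x * f x).
have df (x : R) : is_derive x 1 f (f' x).
  have dp := is_derive_normal_pdf x.
  have dG := is_derive_G x.
  have dV := is_deriveV (lt0r_neq0 (p_gt0 x)) dp.
  have px0 : p x != 0 by rewrite gt_eqF.
  have dM := is_deriveM dG dV.
  have -> : f = s ^- 2 *: (G * (fun y => (p y)^-1)) by [].
  apply: is_derive_eq; rewrite /GRing.scale/= /f' /f /g.
  by field; rewrite px0 s_neq0.
have cf : continuous f.
  by move=> x; apply: differentiable_continuous; apply/derivable1_diffP; case: (df x).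
have cf' : continuous f'.
  move=> x; apply: cvgMr; apply: cvgD; first by apply: cvgB; [exact: ch|exact: cvg_cst].
  by apply: cvgM; [exact: cvg_id|exact: cf].
have xf x : `|x * f x| <= 2 * M.
  rewrite /f mulrCA normrM gtr0_norm ?invr_gt0 ?exprn_gt0//.
  rewrite mulrC ler_pdivrMr ?exprn_gt0// mulrA normrM normfV (gtr0_norm (p_gt0 x)).
  by rewrite ler_pdivrMr.
have f'M x : `|f' x| <= s ^- 2 * (4 * M).
  rewrite /f' normrM gtr0_norm ?invr_gt0 ?exprn_gt0//.
  rewrite ler_wpM2l ?invr_ge0 ?sqr_ge0// (le_trans (ler_normD _ _))//.
  have := xf x; have := hM x; have := cM; have := ler_normB (h x) c; lra.
(* The bound on [x * f x] bounds [f] only away from [0]; on [[-1, 1]] compactness is used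
   instead. *)
have [L1 fL1] : exists L1 : R, forall x, `|x| <= 1 -> `|f x| <= L1.
  have cnf : {within `[(-1)%R, 1%R], continuous (fun x => `|f x|)}.
    by apply: continuous_subspaceT => x; apply: cvg_norm; exact: cf.
  have lem : (-1 : R) <= 1 by lra.
  have [x0 _ H] := EVT_max lem cnf.
  by exists `|f x0| => x x1; apply: H; rewrite in_itv/= -ler_norml.
exists f, f'; split => //; last first.
  by move=> x; rewrite /f'; field; exact: s_neq0.
exists (Num.max (Num.max L1 (2 * M)) (s ^- 2 * (4 * M))) => x; rewrite !le_max f'M orbT; split=> //.
have [x1|x1] := leP `|x| 1; first by rewrite fL1.
apply/orP; left; apply/orP; right; apply: le_trans (xf x).
by rewrite (normrM x); apply: ler_peMl => //; exact: ltW.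
Qed.

End solution.
End stein_equation.

(** * Central limit theorem *)

Section deterministic_bounds.
Context {R : realType}.

(** Only [v] is confined to the segment, while [v + y] may leave it, so this is slightly more than
    Heine's theorem on [[-K, K]]. Near each [x] the continuity radius is halved, one half for [v]
    and one for [y], and compactness makes the choice of [d] uniform. With [K = 0] it is continuity
    at [0]. *)
Lemma uniform_continuity_segment (g : R -> R) (K e : R) :
  continuous g -> 0 < e ->
  exists2 d : R, 0 < d &
    forall v y, `|v| <= K -> `|y| <= d -> `|g (v + y) - g v| <= e.
Proof.
move=> cg e0.
have /compact_near_coveringP H := @segment_compact R (- K) K.
have e2 : 0 < e / 2 by rewrite divr_gt0.
pose Q (d v : R) := forall y : R, `|y| <= d -> `|g (v + y) - g v| <= e.
have HQ : \forall d \near (0:R)^'+, [set` `[- K, K]] `<=` Q d.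
  apply: H => x _.
  have /cvgrPdist_lt/(_ _ e2)/nbhs_ballP[r /= r0 gr] := cg x.
  have r2 : 0 < r / 2 by rewrite divr_gt0.
  exists (ball x (r / 2), [set d : R | d < r / 2]).
    split; first exact: nbhsx_ballx.
    by apply: nbhs_right_lt.
  move=> [v d] /= [xv dr] y yd.
  have h1 : `|g x - g v| < e / 2.
    by apply: gr; apply: le_ball xv; rewrite ler_pdivrMr// ler_peMr ?(ltW r0)// ler1n.
  have h2 : `|g x - g (v + y)| < e / 2.
    apply: gr; rewrite /ball/= opprD addrA; apply: le_lt_trans (ler_normB _ _) _.
    by rewrite [ltRHS]splitr; apply: ltrD => //; exact: le_lt_trans yd dr.
  rewrite -(subrKA (g x)) addrC; apply: le_trans (ler_normD _ _) _.
  by rewrite [leRHS]splitr lerD// ltW// distrC.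
near (0 : R)^'+ => d0.
exists d0 => // v y vK.
have : [set` `[- K, K]] `<=` Q d0 by near: d0; exact: HQ.
by apply; rewrite /= in_itv/= -ler_norml.
Unshelve. all: by end_near. Qed.

(* A bounded substitute for the indicator of [|y| > d] that is linear in [|y|] near [0]. *)
Definition excess (d y : R) : R := Num.min 1 (`|y| / d).

Lemma excess_ge0 d y : 0 < d -> 0 <= excess d y.
Proof. by move=> d0; rewrite le_min ler01 divr_ge0// ltW. Qed.

Lemma excess_le1 d y : excess d y <= 1.
Proof. by rewrite ge_min lexx. Qed.

Lemma excess_le d y : excess d y <= `|y| / d.
Proof. by rewrite ge_min lexx orbT. Qed.

Lemma excess_eq1 d y : 0 < d -> d <= `|y| -> excess d y = 1.
Proof. by move=> d0 dy; apply/min_idPl; rewrite ler_pdivlMr// mul1r. Qed.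

Lemma measurable_excess (d : R) : measurable_fun setT (excess d).
Proof. by apply: measurable_minr => //; apply: measurable_funM. Qed.

End deterministic_bounds.

(** * Taylor remainders with a merely continuous derivative *)

Section remainder.
Context {R : realType}.

(** [f'] is uniformly continuous only near a segment. When [|y| > d] or [|v| > K] the trivial bound
    [2 L] is used, and the corresponding [excess] equals [1] and pays for it. The squares in
    [excess (K ^+ 2) (v ^+ 2)] are there so that its mean is at most a second moment divided by
    [K^2]. *)
Lemma derivative_remainder (f f' : R -> R) (L K e : R) :
  (forall x : R, is_derive x 1 f (f' x)) -> continuous f' ->
  (forall x, `|f' x| <= L) -> 0 < K -> 0 < e ->
  exists2 d : R, 0 < d & forall v y : R,
    `|f' (v + y) - f' v| <=
      e + 2 * L * excess d y + 2 * L * excess (K ^+ 2) (v ^+ 2) /\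
    `|f (v + y) - f v - y * f' v| <=
      `|y| * (e + 2 * L * excess d y + 2 * L * excess (K ^+ 2) (v ^+ 2)).
Proof.
move=> df cf' f'L K0 e0.
have [d d0 dP] := uniform_continuity_segment K cf' e0.
have L0 : 0 <= L by exact: le_trans (f'L 0).
exists d => // v y.
pose B := e + 2 * L * excess d y + 2 * L * excess (K ^+ 2) (v ^+ 2).
have K2 : 0 < K ^+ 2 by rewrite exprn_gt0.
have ey0 := excess_ge0 y d0; have ev0 := excess_ge0 (v ^+ 2) K2.
(* Stated for every increment no larger than [y], since the mean value theorem below yields an
   unknown intermediate one. *)
have key z : `|z| <= `|y| -> `|f' (v + z) - f' v| <= B.
  move=> zy.
  have triv : `|f' (v + z) - f' v| <= 2 * L.
    by rewrite (le_trans (ler_normB _ _))// mulr_natl mulr2n lerD.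
  have Lv := mulr_ge0 (mulr_ge0 (ler0n R 2) L0) ev0.
  have Ly := mulr_ge0 (mulr_ge0 (ler0n R 2) L0) ey0.
  have [yd|yd] := leP `|y| d; last first.
    rewrite (le_trans triv)// /B (excess_eq1 d0 (ltW yd)); lra.
  have [vK|vK] := leP `|v| K.
    by apply: le_trans (dP v z vK (le_trans zy yd)) _; rewrite /B; lra.
  rewrite (le_trans triv)// /B (@excess_eq1 _ (K ^+ 2) (v ^+ 2))//; first by lra.
  by rewrite ger0_norm ?sqr_ge0// -(real_normK (num_real v)) lerXn2r ?nnegrE ?(ltW K0)// ltW.
split; first exact: key.
have cf : continuous f.
  by move=> x; apply: differentiable_continuous; apply/derivable1_diffP; case: (df x).
have [z zy ->] : exists2 z, `|z| <= `|y| & f (v + y) - f v = f' (v + z) * y.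
  have [y0|y0] := leP 0 y.
    have vy : v <= v + y by rewrite lerDl.
    have [c] := MVT_segment vy (fun x _ => df x) (continuous_subspaceT cf).
    rewrite in_itv/= => /andP[c1 c2] H; exists (c - v).
      rewrite !ger0_norm//; lra.
    by rewrite H (_ : v + (c - v) = c); ring.
  have vy : v + y <= v by rewrite gerDl ltW.
  have [c] := MVT_segment vy (fun x _ => df x) (continuous_subspaceT cf).
  rewrite in_itv/= => /andP[c1 c2] H; exists (c - v).
    by rewrite !ler0_norm//; lra.
  by rewrite -(opprB (f v)) H (_ : v + (c - v) = c); ring.
by rewrite mulrC -mulrBr normrM ler_wpM2l// key.
Qed.

End remainder.

(** * Independence of a summand from the others *)

Section leave_one_out.
Context {R : realType} {dO : measure_display} {Omega : measurableType dO}
  (P : probability Omega R).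
Variable X : nat -> Omega -> R.
Hypotheses (mX : forall i, measurable_fun setT (X i))
  (iX : mutually_independent P X).

Lemma leave_one_out_independent (N i : nat) :
  independent2 P (X i) (fun w => \sum_(j < N | j != i :> nat) X j w).
Proof.
pose q1 : pred nat := pred1 i; pose q2 : pred nat := predC1 i.
have q12 j : q1 j -> ~~ q2 j by rewrite /q1 /q2 /= => ->.
have H := mutually_independent_blocks mX q12 iX.
pose E : nat -> measurableType _ := fun _ => R.
have q1i : q1 i by rewrite /q1/=.
pose g1 (x : block E q1) : R := x (exist _ i q1i).
(* The block omits the index [i]; [insub] returns [None] there and the default [0] removes that term
   from the sum. *)
pose g2 (x : block E q2) : R :=
  \sum_(j < N) oapp (fun j' : {j | q2 j} => x j') 0 (insub (j : nat)).
have mg1 : measurable_fun setT g1 by exact: measurable_coordinate.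
have mg2 : measurable_fun setT g2.
  apply: measurable_sum => j.
  case: insubP => [j' _ _|_] /=; first exact: measurable_coordinate.
  exact: measurable_cst.
have := independent2_comp mg1 mg2 H.
rewrite (_ : g2 \o _ = (fun w => \sum_(j < N | j != i :> nat) X j w))//.
apply/funext => w; rewrite /g2 /= [RHS]big_mkcond/=; apply: eq_bigr => j _.
rewrite /block_map; case: insubP => [j' _ <-|]; first by have := svalP j'; rewrite /q2/= => ->.
by rewrite /q2/= => /negbTE ->.
Qed.

Lemma mutually_independent_pair (i j : nat) : i != j -> independent2 P (X i) (X j).
Proof.
move=> ij.
pose q1 : pred nat := pred1 i; pose q2 : pred nat := pred1 j.
have q12 k : q1 k -> ~~ q2 k by rewrite /q1 /q2 /= => /eqP ->.
have H := mutually_independent_blocks mX q12 iX.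
pose E : nat -> measurableType _ := fun _ => R.
have q1i : q1 i by rewrite /q1/=.
have q2j : q2 j by rewrite /q2/=.
pose g1 (x : block E q1) : R := x (exist _ i q1i).
pose g2 (x : block E q2) : R := x (exist _ j q2j).
have mg1 : measurable_fun setT g1 by exact: measurable_coordinate.
have mg2 : measurable_fun setT g2 by exact: measurable_coordinate.
exact: (independent2_comp mg1 mg2 H).
Qed.

End leave_one_out.

(** * Removing one summand in Stein's method *)

Section stein_step.
Context {R : realType} {dO : measure_display} {Omega : measurableType dO}
  (P : probability Omega R).

Lemma Ex_sqr_sum (N : nat) (Y : 'I_N -> Omega -> R) : (forall j, L2 P (Y j)) ->
  (forall j k, j != k -> Ex P (fun w => Y j w * Y k w) = 0) ->
  Ex P (fun w => (\sum_j Y j w) ^+ 2) = \sum_j Ex P (fun w => Y j w ^+ 2).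
Proof.
move=> Y2 Y0.
under eq_fun do rewrite expr2 big_distrlr/=.
rewrite Ex_sum; last by move=> j; apply: L1_sum => k; exact: L2M.
apply: eq_bigr => j _; rewrite Ex_sum; last by move=> k; exact: L2M.
by rewrite (bigD1 j)//= [X in _ + X]big1 ?addr0// => k kj; rewrite Y0// eq_sym.
Qed.

(** Expand [x f(V + x)] at [V]: [x f(V)] has mean [0] as [x] is centered and independent of [V], and
    the mean of [x^2 f'(V)] factors. Going back from [f'(V)] to [f'(V + x)] costs a second
    remainder. Each remainder contributes one [e] and [2 L] times the mean of the excess of [V],
    whence [2 e] and [4 L]; that mean is bounded as in Markov's inequality. *)
Lemma stein_step (f f' : R -> R) (L K e d : R) (x V : Omega -> R) :
  continuous f -> continuous f' ->
  (forall t, `|f t| <= L /\ `|f' t| <= L) -> 0 < K -> 0 < d ->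
  (forall v y : R,
    `|f' (v + y) - f' v| <=
      e + 2 * L * excess d y + 2 * L * excess (K ^+ 2) (v ^+ 2) /\
    `|f (v + y) - f v - y * f' v| <=
      `|y| * (e + 2 * L * excess d y + 2 * L * excess (K ^+ 2) (v ^+ 2))) ->
  L2 P x -> L2 P V -> independent2 P x V -> Ex P x = 0 ->
  `|Ex P (fun w => x w * f (V w + x w)) -
    Ex P (fun w => x w ^+ 2) * Ex P (fun w => f' (V w + x w))| <=
  2 * L * Ex P (fun w => x w ^+ 2 * excess d (x w)) +
  Ex P (fun w => x w ^+ 2) * (2 * e + 2 * L * Ex P (fun w => excess d (x w)) +
    4 * L * (Ex P (fun w => V w ^+ 2) / K ^+ 2)).
Proof.
move=> cf cf' ffL K0 d0 rem x2 V2 ixV Ex0.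
have fL t : `|f t| <= L by case: (ffL t).
have f'L t : `|f' t| <= L by case: (ffL t).
have L0 : 0 <= L by exact: le_trans (fL 0).
have K2 : 0 < K ^+ 2 by rewrite exprn_gt0.
have [mx i2] := x2; have [mV iV2] := V2; have i1 := L2_L1 x2.
have mf : measurable_fun setT f by exact: continuous_measurable_fun.
have mf' : measurable_fun setT f' by exact: continuous_measurable_fun.
pose b (v : R) := excess (K ^+ 2) (v ^+ 2).
have mb : measurable_fun setT b.
  by apply: measurableT_comp; [exact: measurable_excess|exact: measurable_funX].
have b01 v : `|b v| <= 1 by rewrite ger0_norm ?excess_le1 ?excess_ge0.
have ed01 y : `|excess d y| <= 1 by rewrite ger0_norm ?excess_le1 ?excess_ge0.
have mex : measurable_fun setT (fun w => excess d (x w)).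
  by apply: measurableT_comp => //; exact: measurable_excess.
have mbV : measurable_fun setT (fun w => b (V w)) by exact: measurableT_comp.
have mVx : measurable_fun setT (fun w => V w + x w) by exact: measurable_funD.
have mfVx : measurable_fun setT (fun w => f (V w + x w)) by exact: measurableT_comp.
have mf'Vx : measurable_fun setT (fun w => f' (V w + x w)) by exact: measurableT_comp.
have mfV : measurable_fun setT (fun w => f (V w)) by exact: measurableT_comp.
have mf'V : measurable_fun setT (fun w => f' (V w)) by exact: measurableT_comp.
have iex := L1_bounded P mex (fun w => ed01 (x w)).
have ibV := L1_bounded P mbV (fun w => b01 (V w)).
have if'V := L1_bounded P mf'V (fun w => f'L (V w)).
have ifV := L1_bounded P mfV (fun w => fL (V w)).
have if'Vx := L1_bounded P mf'Vx (fun w => f'L (V w + x w)).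
have ixfVx := L1M_bounded i1 mfVx (fun w => fL (V w + x w)).
have ixfV := L1M_bounded i1 mfV (fun w => fL (V w)).
have ix2f'V := L1M_bounded i2 mf'V (fun w => f'L (V w)).
have ix2ex := L1M_bounded i2 mex (fun w => ed01 (x w)).
have ix2b := L1M_bounded i2 mbV (fun w => b01 (V w)).
have msqr : measurable_fun setT (fun t : R => t ^+ 2) by exact: measurable_funX.
have E0 : Ex P (fun w => x w * f (V w)) = 0.
  have ind := independent2_comp (@measurable_id _ R setT) mf ixV.
  by rewrite /Ex (independent2_integralM ind i1 ifV ixfV) -/(Ex P x) Ex0 mul0r.
have E2 : Ex P (fun w => x w ^+ 2 * f' (V w)) =
    Ex P (fun w => x w ^+ 2) * Ex P (fun w => f' (V w)).
  have ind := independent2_comp msqr mf' ixV.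
  exact: (independent2_integralM ind i2 if'V ix2f'V).
have E3 : Ex P (fun w => x w ^+ 2 * b (V w)) =
    Ex P (fun w => x w ^+ 2) * Ex P (fun w => b (V w)).
  have ind := independent2_comp msqr mb ixV.
  exact: (independent2_integralM ind i2 ibV ix2b).
have Eb : Ex P (fun w => b (V w)) <= Ex P (fun w => V w ^+ 2) / K ^+ 2.
  rewrite mulrC -ExZ//; apply: Ex_le => //; first exact: L1Z.
  move=> w; apply: le_trans (excess_le _ _) _.
  by rewrite ger0_norm ?sqr_ge0// mulrC.
pose m := Ex P (fun w => x w ^+ 2).
have m0 : 0 <= m by apply: Ex_ge0 => w; exact: sqr_ge0.
have R1 : `|Ex P (fun w => x w * f (V w + x w)) - m * Ex P (fun w => f' (V w))| <=
    e * m + 2 * L * Ex P (fun w => x w ^+ 2 * excess d (x w)) +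
    2 * L * (m * Ex P (fun w => b (V w))).
  have -> : Ex P (fun w => x w * f (V w + x w)) - m * Ex P (fun w => f' (V w)) =
      Ex P (fun w => x w * f (V w + x w) - x w * f (V w) - x w ^+ 2 * f' (V w)).
    rewrite ExB; [|exact: L1B|exact: ix2f'V].
    by rewrite ExB// E0 subr0 E2.
  rewrite -E3 -!ExZ// -!ExD//; last first.
  - exact: L1Z.
  - exact: L1Z.
  - exact: L1Z.
  - by apply: L1D; exact: L1Z.
  apply: Ex_norm_le.
  - by apply: (@measurable_L1 _ _ _ P); apply: L1B => //; exact: L1B.
  - by apply: L1D; [apply: L1D|]; exact: L1Z.
  move=> w.
  have -> : x w * f (V w + x w) - x w * f (V w) - x w ^+ 2 * f' (V w) =
    x w * (f (V w + x w) - f (V w) - x w * f' (V w)) by ring.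
  rewrite normrM; have [_ H] := rem (V w) (x w).
  apply: le_trans (ler_wpM2l (normr_ge0 _) H) _.
  by rewrite (mulrA `|x w| `|x w|) -expr2 real_normK ?num_real// /b; lra.
have R2 : `|Ex P (fun w => f' (V w + x w)) - Ex P (fun w => f' (V w))| <=
    e + 2 * L * Ex P (fun w => excess d (x w)) + 2 * L * Ex P (fun w => b (V w)).
  rewrite -[in leRHS](Ex_cst P e) -ExB// -!ExZ// -!ExD//; last first.
  - exact: L1Z.
  - exact: L1_cst.
  - exact: L1Z.
  - by apply: L1D; [exact: L1_cst|exact: L1Z].
  apply: Ex_norm_le.
  - by apply: (@measurable_L1 _ _ _ P); exact: L1B.
  - by apply: L1D; [apply: L1D; [exact: L1_cst|]|]; exact: L1Z.
  by move=> w; case: (rem (V w) (x w)).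
rewrite -/m.
set A := Ex P (fun w => x w * f (V w + x w)) in R1 *.
set B := Ex P (fun w => f' (V w)) in R1 R2.
set C := Ex P (fun w => f' (V w + x w)) in R2 *.
have -> : A - m * C = (A - m * B) - m * (C - B) by ring.
apply: le_trans (ler_normB _ _) _.
rewrite (normrM m) (ger0_norm m0).
have := ler_wpM2l m0 R2; have := ler_wpM2l (mulr_ge0 (mulr_ge0 (ler0n R 4) L0) m0) Eb.
move: R1; lra.
Qed.

End stein_step.

Section central_limit.
Context {R : realType} {dO : measure_display} {Omega : measurableType dO}
  (P : probability Omega R).

Lemma cvg_in_law_Ex (T : nat -> Omega -> R) (nu : probability (measurableTypeR R) R) :
  (forall n, measurable_fun setT (T n)) ->
  (forall h : R -> R, continuous h -> (exists M, forall x, `|h x| <= M) ->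
    Ex P (h \o T n) @[n --> \oo] --> Ex nu h) ->
  cvg_in_law P T nu.
Proof.
move=> mT H h ch hM; have [M hM'] := hM.
have mh : measurable_fun setT h by exact: continuous_measurable_fun.
have ih n : L1 P (h \o T n).
  by apply: (@L1_bounded _ _ _ _ _ M) => [|w]; [exact: (measurableT_comp mh (mT n))|exact: hM'].
have inu : L1 nu h by exact: (@L1_bounded _ _ _ _ _ M).
have -> : (\int[nu]_x (h x)%:E)%E = (Ex nu h)%:E.
  by rewrite fineK//; exact: (integrable_fin_num measurableT inu).
under eq_cvg do rewrite expectation_Ex//.
by apply: cvg_EFin; [exact: nearW|exact: H].
Qed.

Lemma cvg_invsqrt : (Num.sqrt (n%:R : R))^-1 @[n --> \oo] --> (0 : R).
Proof.
apply/(@gtr0_cvgV0 R nat \oo _ (fun n => Num.sqrt (n%:R : R))).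
  near=> n; rewrite sqrtr_gt0 ltr0n; near: n; exact: nbhs_infty_gt.
apply/cvgryPge => A; near=> n.
have A2 : A ^+ 2 <= n%:R by near: n; exact: nbhs_infty_ger.
by apply: le_trans (ler_norm A) _; rewrite -sqrtr_sqr ler_sqrt.
Unshelve. all: by end_near. Qed.

(** This plays the part of Lindeberg's condition, with [Y] equal to [X^2] or to [1]. Dominated
    convergence applies: the integrand is at most [|Y|] since [excess] is at most [1], and at most
    [|Y| |X| / (d sqrt n)], which tends to [0]. *)
Lemma Ex_excess_cvg (Y X : Omega -> R) (d : R) : 0 < d ->
  L1 P Y -> measurable_fun setT X ->
  Ex P (fun w => Y w * excess d ((Num.sqrt n%:R)^-1 * X w)) @[n --> \oo] --> (0 : R).
Proof.
move=> d0 iY mX.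
have mY := measurable_L1 iY.
have mF n : measurable_fun setT
    (fun w => (Y w * excess d ((Num.sqrt n%:R)^-1 * X w))%:E).
  apply/measurable_EFinP/measurable_funM => //.
  apply: measurableT_comp; first exact: measurable_excess.
  exact: measurable_funM.
have b01 y : `|excess d y| <= 1 by rewrite ger0_norm ?excess_le1 ?excess_ge0.
have isq := cvg_invsqrt.
have H := @dominated_cvg _ _ _ P setT measurableT
  (fun n w => (Y w * excess d ((Num.sqrt n%:R)^-1 * X w))%:E) (cst 0%E)
  (fun w => `|(Y w)%:E|%E) mF.
have -> : (fun n => Ex P (fun w => Y w * excess d ((Num.sqrt n%:R)^-1 * X w))) =
    fine \o (fun n => (\int[P]_w (Y w * excess d ((Num.sqrt n%:R)^-1 * X w))%:E)%E) by [].
apply: fine_cvg.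
have -> : 0%:E = (\int[P]_w (cst 0%E w : \bar R))%E :> \bar R by rewrite integral0.
apply: H.
- move=> w _; apply: cvg_EFin; first exact: nearW.
  apply/cvgrPdist_le => e e0 /=.
  have : (`|Y w| * (`|X w| / d) * (Num.sqrt (n%:R : R))^-1) @[n --> \oo] --> (0 : R).
    by rewrite -(mulr0 (`|Y w| * (`|X w| / d))); exact: cvgMr.
  move/cvgrPdist_le => /(_ _ e0); apply: filterS => n /=.
  have i0 : 0 <= (Num.sqrt (n%:R : R))^-1 by rewrite invr_ge0.
  have A0 : 0 <= `|Y w| * (`|X w| / d) * (Num.sqrt (n%:R : R))^-1.
    by rewrite mulr_ge0// mulr_ge0// divr_ge0// ltW.
  rewrite !sub0r !normrN (ger0_norm A0); apply: le_trans.
  rewrite normrM (ger0_norm (excess_ge0 _ d0)) -mulrA ler_wpM2l//.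
  apply: le_trans (excess_le _ _) _.
  by rewrite normrM (ger0_norm i0) (mulrC _ `|X w|) mulrAC.
- by [].
- exact: integrable_abse iY.
- move=> n w _; rewrite /= lee_fin normrM -[leRHS]mulr1 ler_wpM2l//.
Qed.

Variable X : nat -> Omega -> R.
Hypotheses (mX : forall i, measurable_fun setT (X i))
  (iX : mutually_independent P X) (lX : forall i, same_law P (X i) (X 0%N))
  (X2 : L2 P (X 0%N)) (X0 : Ex P (X 0%N) = 0).

Let v := Ex P (fun w => X 0%N w ^+ 2).

Lemma iid_transfer (g : R -> R) i : measurable_fun setT g -> L1 P (g \o X 0%N) ->
  L1 P (g \o X i) /\ Ex P (g \o X i) = Ex P (g \o X 0%N).
Proof.
move=> mg ig.
have l0 : same_law P (X 0%N) (X i) by move=> A mA; rewrite lX.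
by have [h1 h2] := same_law_integral (mX 0%N) (mX i) mg l0 ig; split.
Qed.

Let msqr : measurable_fun setT (fun t : R => t ^+ 2).
Proof. exact: measurable_funX. Qed.

Lemma iid_L2 i : L2 P (X i).
Proof.
split=> //; have [_ h] := X2.
by have [] := iid_transfer i msqr h.
Qed.

Lemma iid_Ex i : Ex P (X i) = 0.
Proof. by rewrite -X0; have [] := iid_transfer i (@measurable_id _ _ _) (L2_L1 X2). Qed.

Lemma iid_Ex_sqr i : Ex P (fun w => X i w ^+ 2) = v.
Proof. by have [_ h] := X2; have [] := iid_transfer i msqr h. Qed.

(** Cross terms vanish by pairwise independence and centering. The predicate [Q] covers both the
    full sum and the sum with one index removed. *)
Lemma iid_Ex_sqr_sum (N : nat) (Q : pred 'I_N) :
  Ex P (fun w => (\sum_(j < N | Q j) X j w) ^+ 2) = \sum_(j < N | Q j) v.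
Proof.
pose Y (j : 'I_N) w := if Q j then X j w else 0.
under eq_fun do rewrite big_mkcond.
rewrite (@Ex_sqr_sum _ _ _ P N Y).
- rewrite [RHS]big_mkcond; apply: eq_bigr => j _; rewrite /Y.
  by case: (Q j); [exact: iid_Ex_sqr|under eq_fun do rewrite expr0n; rewrite Ex_cst].
- by move=> j; rewrite /Y; case: (Q j); [exact: iid_L2|exact: L2_cst].
move=> j k jk; rewrite /Y; case: (Q j); last first.
  by under eq_fun do rewrite mul0r; rewrite Ex_cst.
case: (Q k); last by under eq_fun do rewrite mulr0; rewrite Ex_cst.
rewrite /Ex (independent2_integralM (mutually_independent_pair mX iX jk))//.
- by rewrite -/(Ex P (X j)) iid_Ex mul0r.
- exact: L2_L1 (iid_L2 j).
- exact: L2_L1 (iid_L2 k).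
- exact: L2M (iid_L2 j) (iid_L2 k).
Qed.

Definition normalized_sum (N : nat) (w : Omega) : R :=
  (Num.sqrt N%:R)^-1 * \sum_(i < N) X i w.

Lemma L2_normalized_sum N : L2 P (normalized_sum N).
Proof. by apply: L2Z; apply: L2_sum => i; exact: iid_L2. Qed.

(** There is equality for [N > 0]; for [N = 0] the sum is [0], so the inequality is what holds
    uniformly. *)
Lemma Ex_sqr_normalized_sum N : Ex P (fun w => normalized_sum N w ^+ 2) <= v.
Proof.
have v0 : 0 <= v by apply: Ex_ge0 => w; exact: sqr_ge0.
under eq_fun do rewrite exprMn.
rewrite ExZ; last by case: (@L2_sum _ _ _ P _ (index_enum 'I_N) _ (fun i => iid_L2 i)).
rewrite (@iid_Ex_sqr_sum N xpredT) sumr_const card_ord exprVn sqr_sqrtr//.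
case: N => [|N]; first by rewrite mulr0n mulr0.
by rewrite -(mulr_natr v) mulrCA mulVf ?mulr1// pnatr_eq0.
Qed.

(** Each of the [N] summands [X_i / sqrt N] has variance [v / N] and leaves a rest of second moment
    at most [v]; [stein_step] bounds its contribution by [B / N], and the total is [B]. The factor
    [1 *] in the bound matches the form of [Ex_excess_cvg] for a constant [Y]. *)
Lemma stein_sum (f f' : R -> R) (L K e d : R) (N : nat) : (0 < N)%N ->
  continuous f -> continuous f' ->
  (forall t, `|f t| <= L /\ `|f' t| <= L) -> 0 < K -> 0 < d ->
  (forall v y : R,
    `|f' (v + y) - f' v| <=
      e + 2 * L * excess d y + 2 * L * excess (K ^+ 2) (v ^+ 2) /\
    `|f (v + y) - f v - y * f' v| <=
      `|y| * (e + 2 * L * excess d y + 2 * L * excess (K ^+ 2) (v ^+ 2))) ->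
  `|Ex P (fun w => normalized_sum N w * f (normalized_sum N w)) -
    v * Ex P (fun w => f' (normalized_sum N w))| <=
  2 * L * Ex P (fun w => X 0%N w ^+ 2 * excess d ((Num.sqrt N%:R)^-1 * X 0%N w)) +
  v * (2 * e + 2 * L * Ex P (fun w => 1 * excess d ((Num.sqrt N%:R)^-1 * X 0%N w)) +
    4 * L * (v / K ^+ 2)).
Proof.
move=> N0 cf cf' ffL K0 d0 rem.
pose r : R := (Num.sqrt N%:R)^-1.
have v0 : 0 <= v by apply: Ex_ge0 => w; exact: sqr_ge0.
have L0 : 0 <= L by have [h _] := ffL 0; exact: le_trans h.
have r2 : r ^+ 2 = N%:R^-1 by rewrite exprVn sqr_sqrtr.
have Nr0 : (N%:R : R) != 0 by rewrite pnatr_eq0 -lt0n.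
have mf : measurable_fun setT f by exact: continuous_measurable_fun.
pose x (i : nat) w := r * X i w.
pose V (i : nat) w := r * \sum_(j < N | j != i :> nat) X j w.
have WE (i : 'I_N) w : normalized_sum N w = V i w + x i w.
  by rewrite /normalized_sum (bigD1 i)//= mulrDr addrC.
have WS w : normalized_sum N w = \sum_(i < N) x i w by rewrite /x -mulr_sumr.
have x2 i : L2 P (x i) by apply: L2Z; exact: iid_L2.
have V2 i : L2 P (V i).
  apply: L2Z; under eq_fun do rewrite big_mkcond; apply: L2_sum => j.
  by case: (_ != _); [exact: iid_L2|exact: L2_cst].
have Ex0 i : Ex P (x i) = 0 by rewrite ExZ ?iid_Ex ?mulr0//; exact: L2_L1 (iid_L2 i).
have Ex2 i : Ex P (fun w => x i w ^+ 2) = v / N%:R.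
  rewrite /x; under eq_fun do rewrite exprMn.
  by rewrite ExZ ?iid_Ex_sqr ?r2 1?mulrC//; case: (iid_L2 i).
have EV2 i : Ex P (fun w => V i w ^+ 2) <= v.
  rewrite /V; under eq_fun do rewrite exprMn.
  rewrite ExZ; last first.
    suff [] : L2 P (fun w => \sum_(j < N | j != i :> nat) X j w) by [].
    under eq_fun do rewrite big_mkcond; apply: L2_sum => j.
    by case: (_ != _); [exact: iid_L2|exact: L2_cst].
  rewrite (@iid_Ex_sqr_sum N (fun j => j != i :> nat)) r2 ler_pdivrMl ?ltr0n//.
  apply: (@le_trans _ _ (\sum_(j < N) v)).
    by rewrite big_mkcond/=; apply: ler_sum => j _; case: ifP.
  by rewrite sumr_const card_ord mulr_natl.
have mscale : measurable_fun setT (fun t : R => r * t) by exact: measurable_funM.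
have ind i : independent2 P (x i) (V i).
  exact: (independent2_comp mscale mscale (leave_one_out_independent mX iX N i)).
have b01 y : `|excess d y| <= 1 by rewrite ger0_norm ?excess_le1 ?excess_ge0.
have mex : measurable_fun setT (fun t => excess d (r * t)).
  by apply: (measurableT_comp _ mscale); exact: measurable_excess.
have mexX i : measurable_fun setT (fun w => excess d (r * X i w)).
  exact: (measurableT_comp mex (mX i)).
pose tau := Ex P (fun w => X 0%N w ^+ 2 * excess d (r * X 0%N w)).
pose kap := Ex P (fun w => 1 * excess d (r * X 0%N w)).
have Etau i : Ex P (fun w => x i w ^+ 2 * excess d (x i w)) = tau / N%:R.
  have i0 : L1 P (fun w => X 0%N w ^+ 2 * excess d (r * X 0%N w)).
    have [_ h] := X2.
    exact: (L1M_bounded h (mexX 0%N) (fun w => b01 _)).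
  have mg : measurable_fun setT (fun t : R => t ^+ 2 * excess d (r * t)).
    exact: measurable_funM.
  have [h1 h2] := iid_transfer i mg i0.
  rewrite /x; under eq_fun do rewrite exprMn r2 -mulrA.
  by rewrite ExZ// mulrC; congr (_ * _); exact: h2.
have Ekap i : Ex P (fun w => excess d (x i w)) = kap.
  have i0 : L1 P (fun w => excess d (r * X 0%N w)).
    exact: (L1_bounded P (mexX 0%N) (fun w => b01 _)).
  have [_ h2] := iid_transfer i mex i0.
  by rewrite /kap; under [in RHS]eq_fun do rewrite mul1r; exact: h2.
pose B := 2 * L * tau + v * (2 * e + 2 * L * kap + 4 * L * (v / K ^+ 2)).
rewrite -/r -/tau -/kap -/B.
have mW : measurable_fun setT (fun w => f (normalized_sum N w)).
  by apply: (measurableT_comp mf); case: (L2_normalized_sum N).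
have step (i : 'I_N) :
    `|Ex P (fun w => x i w * f (normalized_sum N w)) -
      v / N%:R * Ex P (fun w => f' (normalized_sum N w))| <= B / N%:R.
  have := stein_step cf cf' ffL K0 d0 rem (x2 i) (V2 i) (ind i) (Ex0 i).
  rewrite Ex2 Etau Ekap.
  under eq_fun do rewrite -WE; under [in X in _ * X]eq_fun do rewrite -WE.
  move/le_trans; apply.
  have K2 : 0 <= K ^- 2 by rewrite invr_ge0 sqr_ge0.
  have H : 4 * L * (Ex P (fun w => V i w ^+ 2) / K ^+ 2) <= 4 * L * (v / K ^+ 2).
    by rewrite ler_wpM2l ?mulr_ge0// ler_wpM2r.
  have vN : 0 <= v / N%:R by rewrite divr_ge0.
  have -> : B / N%:R = 2 * L * (tau / N%:R) +
      v / N%:R * (2 * e + 2 * L * kap + 4 * L * (v / K ^+ 2)) by rewrite /B; ring.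
  by rewrite lerD2l ler_wpM2l// lerD2l.
under eq_fun do rewrite {1}WS mulr_suml.
rewrite Ex_sum; last first.
  move=> i; apply: (@L1M_bounded _ _ _ P _ _ L (L2_L1 (x2 i)) mW) => w.
  by case: (ffL (normalized_sum N w)).
have -> : v * Ex P (fun w => f' (normalized_sum N w)) =
    \sum_(i < N) v / N%:R * Ex P (fun w => f' (normalized_sum N w)).
  rewrite sumr_const card_ord -(mulr_natr (_ * Ex _ _)); field.
  exact: Nr0.
rewrite -sumrB; apply: le_trans (ler_norm_sum _ _ _) _.
apply: (@le_trans _ _ (\sum_(i < N) B / N%:R)).
  by apply: ler_sum => i _; exact: step.
by rewrite sumr_const card_ord -(mulr_natr (B / _)) divfK.
Qed.

End central_limit.

(** * Passage to the limit for iid sums *)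

Section clt.
Context {R : realType} {dO : measure_display} {Omega : measurableType dO}
  (P : probability Omega R).
Variable X : nat -> Omega -> R.
Hypotheses (mX : forall i, measurable_fun setT (X i))
  (iX : mutually_independent P X) (lX : forall i, same_law P (X i) (X 0%N))
  (X2 : L2 P (X 0%N)) (X0 : Ex P (X 0%N) = 0).

Let v := Ex P (fun w => X 0%N w ^+ 2).
Let Z := normalized_sum X.

Let mZ n : measurable_fun setT (Z n).
Proof. by have [] := L2_normalized_sum mX lX X2 n. Qed.

(** Here [Z n] has zero second moment. Continuity of [h] at [0] controls [|h(Z n) - h 0|] by [e]
    when [|Z n| <= d], and by [2 M Z_n^2 / d^2] otherwise; the latter has mean [0]. *)
Let clt_degenerate (h : R -> R) (M : R) : continuous h ->
  (forall x, `|h x| <= M) -> v = 0 -> Ex P (h \o Z n) @[n --> \oo] --> h 0.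
Proof.
move=> ch hM v0; apply/cvgrPdist_le => e e0; apply: nearW => n.
have mh : measurable_fun setT h by exact: continuous_measurable_fun.
have [d d0 dP] := uniform_continuity_segment 0 ch e0.
have [mZn iZ2] := L2_normalized_sum mX lX X2 n.
have M0 : 0 <= M by exact: le_trans (hM 0).
have EZ : Ex P (fun w => Z n w ^+ 2) = 0.
  apply/eqP; rewrite eq_le Ex_ge0 ?andbT; last by move=> w; exact: sqr_ge0.
  by rewrite -v0; exact: Ex_sqr_normalized_sum.
have ih : L1 P (h \o Z n).
  by apply: (@L1_bounded _ _ _ P _ M (measurableT_comp mh mZn)) => w; exact: hM.
have ibd : L1 P (fun w => 2 * M / d ^+ 2 * Z n w ^+ 2) by exact: L1Z.
rewrite -(Ex_cst P (h 0)) -ExB//; last exact: L1_cst.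
have -> : e = Ex P (fun w => e + 2 * M / d ^+ 2 * Z n w ^+ 2).
  by rewrite ExD ?Ex_cst ?ExZ ?EZ ?mulr0 ?addr0//; exact: L1_cst.
apply: Ex_norm_le.
- by apply: (@measurable_L1 _ _ _ P); apply: L1B => //; exact: L1_cst.
- by apply: L1D => //; exact: L1_cst.
move=> w; have [zd|zd] := leP `|Z n w| d.
  have z0 : `|0 : R| <= 0 by rewrite normr0.
  have := dP _ _ z0 zd; rewrite add0r distrC => /le_trans; apply.
  by rewrite lerDl mulr_ge0 ?sqr_ge0// divr_ge0 ?sqr_ge0// mulr_ge0.
apply: (@le_trans _ _ (2 * M)).
  by rewrite (le_trans (ler_normB _ _))// mulr_natl mulr2n lerD//; exact: hM.
have : 1 <= Z n w ^+ 2 / d ^+ 2.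
  rewrite ler_pdivlMr ?exprn_gt0// mul1r -(real_normK (num_real (Z n w))).
  by rewrite lerXn2r ?nnegrE ?(ltW d0)// ltW.
move/(ler_wpM2l (mulr_ge0 (ler0n R 2) M0)); rewrite mulr1 => /le_trans; apply.
by rewrite mulrA mulrAC lerDr ltW.
Qed.

Let clt_nondegenerate (h : R -> R) (M : R) : continuous h ->
  (forall x, `|h x| <= M) -> 0 < v ->
  Ex P (h \o Z n) @[n --> \oo] --> Ex (normal_prob 0 (Num.sqrt v)) h.
Proof.
move=> ch hM v0.
have s0 : 0 < Num.sqrt v by rewrite sqrtr_gt0.
have mh : measurable_fun setT h by exact: continuous_measurable_fun.
have [f [f' [df cf' [L fL]]]] := stein_solution s0 ch hM.
rewrite sqr_sqrtr ?ltW// => stein.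
have cf : continuous f.
  by move=> x; apply: differentiable_continuous; apply/derivable1_diffP; case: (df x).
have L0 : 0 <= L by have [h0 _] := fL 0; exact: le_trans h0.
have mf : measurable_fun setT f by exact: continuous_measurable_fun.
have mf' : measurable_fun setT f' by exact: continuous_measurable_fun.
apply/cvgrPdist_le => eta eta0.
(* The constants give each of the four terms of [stein_sum] at most [eta / 4]: [e], [e1] and [e2] do
   so for the modulus of continuity and the two excesses. As [K >= 1], [K^2 >= K], and [K] exceeds
   [16 L v^2 / eta]. Writing [L + 1] keeps the divisors positive when [L = 0]. *)
pose e := eta / (8 * v).
have e0 : 0 < e by rewrite divr_gt0// mulr_gt0.
pose K := 1 + 16 * L * v ^+ 2 / eta.
have K1 : 1 <= K.
  rewrite lerDl; apply: divr_ge0; last exact: ltW.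
  by apply: mulr_ge0; [exact: mulr_ge0|exact: sqr_ge0].
have K0 : 0 < K by exact: lt_le_trans K1.
have [d d0 rem] := derivative_remainder df cf' (fun x => (fL x).2) K0 e0.
have [_ iX2] := X2.
have c1 := Ex_excess_cvg d0 iX2 (mX 0%N).
have c2 := Ex_excess_cvg d0 (L1_cst P 1) (mX 0%N).
pose e1 := eta / (8 * (L + 1)).
pose e2 := eta / (8 * (L + 1) * v).
have L1p : 0 < L + 1 by rewrite ltr_wpDl.
have e10 : 0 < e1 by rewrite divr_gt0// mulr_gt0.
have e20 : 0 < e2 by rewrite divr_gt0// !mulr_gt0.
move/cvgrPdist_le : c1 => /(_ _ e10) c1.
move/cvgrPdist_le : c2 => /(_ _ e20) c2.
near=> n.
have n0 : (0 < n)%N by near: n; exact: nbhs_infty_gt.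
have t1 : `|0 - Ex P (fun w => X 0 w ^+ 2 * excess d ((Num.sqrt n%:R)^-1 * X 0%N w))| <= e1.
  by near: n; exact: c1.
have t2 : `|0 - Ex P (fun w => 1 * excess d ((Num.sqrt n%:R)^-1 * X 0%N w))| <= e2.
  by near: n; exact: c2.
have := stein_sum mX iX lX X2 X0 n0 cf cf' fL K0 d0 rem.
rewrite -/v -/Z.
set t := Ex P (fun w => X 0 w ^+ 2 * _) in t1 *.
set k := Ex P (fun w => 1 * _) in t2 *.
rewrite !sub0r !normrN in t1 t2.
have {}t1 : t <= e1 by exact: le_trans (ler_norm _) t1.
have {}t2 : k <= e2 by exact: le_trans (ler_norm _) t2.
have [mZn iZ2] := L2_normalized_sum mX lX X2 n.
have iZf : L1 P (fun w => Z n w * f (Z n w)).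
  apply: (@L1M_bounded _ _ _ P _ _ L (L2_L1 (L2_normalized_sum mX lX X2 n))).
    exact: (measurableT_comp mf mZn).
  by move=> w; case: (fL (Z n w)).
have if' : L1 P (fun w => f' (Z n w)).
  apply: (@L1_bounded _ _ _ P _ L (measurableT_comp mf' mZn)) => w.
  by case: (fL (Z n w)).
have ih : L1 P (h \o Z n).
  by apply: (@L1_bounded _ _ _ P _ M (measurableT_comp mh mZn)) => w; exact: hM.
(* Stein's equation evaluated at [Z n] and integrated: the quantity bounded by [stein_sum] is the
   error to be estimated. *)
have -> : Ex P (fun w => Z n w * f (Z n w)) - v * Ex P (fun w => f' (Z n w)) =
    Ex (normal_prob 0 (Num.sqrt v)) h - Ex P (h \o Z n).
  rewrite -ExZ// -ExB//; last exact: L1Z.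
  rewrite -(Ex_cst P (Ex (normal_prob 0 (Num.sqrt v)) h)) -ExB//; last exact: L1_cst.
  congr Ex; apply/funext => w /=.
  have H : v * f' (Z n w) - Z n w * f (Z n w) =
    h (Z n w) - Ex (normal_prob 0 (Num.sqrt v)) h := stein (Z n w).
  by rewrite -[RHS]opprB -H opprB.
move/le_trans; apply.
have b1 : 2 * L * t <= eta / 4.
  apply: (@le_trans _ _ (2 * L * e1)); first by rewrite ler_wpM2l// mulr_ge0.
  rewrite /e1 mulrA ler_pdivrMr ?mulr_gt0//.
  have := mulr_ge0 L0 (ltW eta0); lra.
have b2 : v * (2 * e) <= eta / 4.
  by rewrite le_eqVlt; apply/orP; left; apply/eqP; rewrite /e; field; rewrite gt_eqF.
have b3 : v * (2 * L * k) <= eta / 4.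
  apply: (@le_trans _ _ (v * (2 * L * e2))).
    by rewrite ler_wpM2l ?(ltW v0)// ler_wpM2l// mulr_ge0.
  have -> : v * (2 * L * e2) = 2 * L * e1.
    by rewrite /e2 /e1; field; rewrite !gt_eqF.
  rewrite /e1 mulrA ler_pdivrMr ?mulr_gt0//.
  have := mulr_ge0 L0 (ltW eta0); lra.
have b4 : v * (4 * L * (v / K ^+ 2)) <= eta / 4.
  have -> : v * (4 * L * (v / K ^+ 2)) = 4 * L * v ^+ 2 / K ^+ 2 by field; rewrite gt_eqF.
  rewrite ler_pdivrMr ?exprn_gt0//.
  apply: (@le_trans _ _ (eta / 4 * K)).
    have -> : eta / 4 * K = eta / 4 + 4 * L * v ^+ 2 by rewrite /K; field; rewrite gt_eqF.
    by rewrite lerDr ltW// divr_gt0.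
  rewrite ler_wpM2l ?divr_ge0 ?(ltW eta0)// expr2 ler_peMl// ltW//.
by move: b1 b2 b3 b4; rewrite !mulrDr; lra.
Unshelve. all: by end_near. Qed.

Theorem central_limit (h : R -> R) (M : R) : continuous h ->
  (forall x, `|h x| <= M) -> Ex P (h \o Z n) @[n --> \oo] --> Ex (gaussian v) h.
Proof.
move=> ch hM.
have mh : measurable_fun setT h by exact: continuous_measurable_fun.
rewrite /gaussian; case: eqVneq => [v0|v0].
  rewrite [X in _ --> X](_ : _ = h 0); first exact: clt_degenerate hM v0.
  rewrite /Ex /Rintegral integral_dirac//; last exact/measurable_EFinP.
  by rewrite diracT mul1e.
apply: clt_nondegenerate hM _ => //.
by rewrite lt_def v0 Ex_ge0// => w; exact: sqr_ge0.
Qed.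

End clt.

(** * Slutsky's argument for ratios *)

Section slutsky.
Context {R : realType}.

(* [t] is the ratio except where the denominator vanishes, where the estimator takes
   the junk value [0]; this only happens when [psi] is far from [v] or [q] is large. *)
Lemma ratio_perturbation (h : R -> R) (M K e v c : R) :
  continuous h -> (forall x, `|h x| <= M) -> 0 < K -> 0 < e -> 0 < v ->
  exists2 d : R, 0 < d & forall t z q Q psi : R, 0 <= Q -> Q <= q ->
    (psi - Q != 0 -> t = (v * z - c * q) / (psi - Q)) ->
    `|h t - h z| <=
      e + 2 * M * (z ^+ 2 / K ^+ 2 + q / d + (psi - v) ^+ 2 / d ^+ 2).
Proof.
move=> ch hM K0 e0 v0.
have [d1 d10 dP] := uniform_continuity_segment K ch e0.
have M0 : 0 <= M by exact: le_trans (hM 0).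
have c0 := normr_ge0 c.
have D0 : 0 < 2 * K + `|c| by rewrite ltr_wpDr// mulr_gt0.
(* When [q] and [|psi - v|] are at most [d], the first bound gives [psi - Q >= v / 2]. If moreover
   [|z| <= K], the numerator of [t - z] is at most [d (2 K + |c|)], so the second bound gives
   [|t - z| <= d1]. *)
pose d := Num.min (v / 4) (d1 * v / (2 * (2 * K + `|c|))).
have d0 : 0 < d by rewrite lt_min !divr_gt0//= ?mulr_gt0.
exists d => // t z q Q psi Q0 Qq tE.
have q0 : 0 <= q by exact: le_trans Qq.
pose B := z ^+ 2 / K ^+ 2 + q / d + (psi - v) ^+ 2 / d ^+ 2.
have t1 : 0 <= z ^+ 2 / K ^+ 2 by rewrite divr_ge0// sqr_ge0.
have t2 : 0 <= q / d by rewrite divr_ge0// ltW.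
have t3 : 0 <= (psi - v) ^+ 2 / d ^+ 2 by rewrite divr_ge0// sqr_ge0.
(* As soon as one of the three error terms reaches [1], the trivial bound [2 M] suffices; no formula
   for [t] enters, which covers the vanishing denominator. *)
have big : 1 <= B -> `|h t - h z| <= e + 2 * M * B.
  move=> B1; apply: (@le_trans _ _ (2 * M)).
    by rewrite (le_trans (ler_normB _ _))// mulr_natl mulr2n lerD.
  have := ler_wpM2l (mulr_ge0 (ler0n R 2) M0) B1; rewrite mulr1 => /le_trans; apply.
  by rewrite lerDr ltW.
have sq1 (a b : R) : 0 < b -> b < `|a| -> 1 <= a ^+ 2 / b ^+ 2.
  move=> b0 ba; rewrite ler_pdivlMr ?exprn_gt0// mul1r -(real_normK (num_real a)).
  by rewrite lerXn2r ?nnegrE ?(ltW b0)// ltW.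
have [zK|zK] := leP `|z| K; last first.
  by apply: big; have := sq1 _ _ K0 zK; rewrite /B; lra.
have [qd|qd] := leP q d; last first.
  apply: big; have : 1 <= q / d by rewrite ler_pdivlMr// mul1r ltW.
  by rewrite /B; lra.
have [pd|pd] := leP `|psi - v| d; last first.
  by apply: big; have := sq1 _ _ d0 pd; rewrite /B; lra.
have dv : d <= v / 4 by rewrite ge_min lexx.
have dd : d * (2 * (2 * K + `|c|)) <= d1 * v.
  by rewrite -ler_pdivlMr ?mulr_gt0// ge_min lexx orbT.
move: (pd); rewrite ler_norml => /andP[p1 p2].
have den : v / 2 <= psi - Q by lra.
have den0 : 0 < psi - Q by apply: lt_le_trans den; rewrite divr_gt0.
pose y := (v * z - c * q) / (psi - Q) - z.
have yE : y = ((v - psi + Q) * z - c * q) / (psi - Q).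
  by rewrite /y; field; rewrite gt_eqF.
have yd : `|y| <= d1.
  rewrite yE normrM normfV (gtr0_norm den0) ler_pdivrMr//.
  apply: (@le_trans _ _ (d1 * (v / 2))); last by rewrite ler_wpM2l// ltW.
  apply: le_trans (ler_normB _ _) _; rewrite !normrM (ger0_norm q0).
  have h1 : `|v - psi + Q| * `|z| <= (2 * d) * K.
    apply: ler_pM => //; apply: le_trans (ler_normD _ _) _.
    rewrite distrC (ger0_norm Q0); lra.
  have h2 : `|c| * q <= `|c| * d by rewrite ler_wpM2l.
  lra.
have -> : t = z + y by rewrite tE ?gt_eqF// /y [RHS]addrCA subrr addr0.
apply: le_trans (dP z y zK yd) _.
by rewrite lerDl mulr_ge0 ?mulr_ge0// !addr_ge0.
Qed.

Context {dO : measure_display} {Omega : measurableType dO} (P : probability Omega R).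

(** Integrating the pointwise bound of [ratio_perturbation] lets moments of [Z n], [q n] and
    [psi n - v] replace convergence in probability. The second moment of [Z n] need only stay
    bounded, because [K] can be taken large. *)
Lemma ratio_slutsky (Z q Q psi T : nat -> Omega -> R) (v c C l : R) (h : R -> R) (M : R) :
  0 < v -> continuous h -> (forall x, `|h x| <= M) ->
  (forall n, L2 P (Z n)) -> (forall n, Ex P (fun w => Z n w ^+ 2) <= C) ->
  (forall n, L1 P (q n)) -> Ex P (q n) @[n --> \oo] --> (0 : R) ->
  (forall n, L2 P (fun w => psi n w - v)) ->
  Ex P (fun w => (psi n w - v) ^+ 2) @[n --> \oo] --> (0 : R) ->
  (forall n, measurable_fun setT (T n)) ->
  (forall n w, (0 < n)%N -> 0 <= Q n w /\ Q n w <= q n w) ->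
  (forall n w, (0 < n)%N -> psi n w - Q n w != 0 ->
    T n w = (v * Z n w - c * q n w) / (psi n w - Q n w)) ->
  Ex P (h \o Z n) @[n --> \oo] --> l -> Ex P (h \o T n) @[n --> \oo] --> l.
Proof.
move=> v0 ch hM Z2 ZC iq q0 p2 p0 mT Qq TE Zl.
have mh : measurable_fun setT h by exact: continuous_measurable_fun.
have M0 : 0 <= M by exact: le_trans (hM 0).
have C0 : 0 <= C by apply: le_trans (ZC 0%N); apply: Ex_ge0 => w; exact: sqr_ge0.
apply/cvgrPdist_le => eta eta0.
(* Five errors of size [e]: the convergence for [Z n], the modulus of continuity of [h], and the
   three expectations. [K >= 1] together with [K > 2 M C / e] handles the first expectation; [M + 1]
   keeps the divisors of [e1] and [e2] positive. *)
pose e := eta / 5.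
have e0 : 0 < e by rewrite divr_gt0.
pose K := 1 + 2 * M * C / e.
have K1 : 1 <= K.
  rewrite lerDl; apply: divr_ge0; last exact: ltW.
  by apply: mulr_ge0 => //; exact: mulr_ge0.
have K0 : 0 < K by exact: lt_le_trans K1.
have [d d0 dP] := ratio_perturbation c ch hM K0 e0 v0.
have M1 : 0 < 2 * (M + 1) by rewrite mulr_gt0// ltr_wpDl.
pose e1 := e * d / (2 * (M + 1)).
pose e2 := e * d ^+ 2 / (2 * (M + 1)).
have e10 : 0 < e1 by rewrite divr_gt0// mulr_gt0.
have e20 : 0 < e2 by rewrite divr_gt0// mulr_gt0// exprn_gt0.
move/cvgrPdist_le : q0 => /(_ _ e10) q0.
move/cvgrPdist_le : p0 => /(_ _ e20) p0.
move/cvgrPdist_le : Zl => /(_ _ e0) Zl.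
near=> n.
have n0 : (0 < n)%N by near: n; exact: nbhs_infty_gt.
have h1 : `|0 - Ex P (q n)| <= e1 by near: n; exact: q0.
have h2 : `|0 - Ex P (fun w => (psi n w - v) ^+ 2)| <= e2 by near: n; exact: p0.
have h3 : `|l - Ex P (h \o Z n)| <= e by near: n; exact: Zl.
rewrite sub0r normrN in h1; rewrite sub0r normrN in h2.
have {}h1 := le_trans (ler_norm _) h1; have {}h2 := le_trans (ler_norm _) h2.
have [mZn iZ2] := Z2 n; have [_ ip] := p2 n.
have ihZ : L1 P (h \o Z n).
  by apply: (@L1_bounded _ _ _ P _ M (measurableT_comp mh mZn)) => w; exact: hM.
have ihT : L1 P (h \o T n).
  by apply: (@L1_bounded _ _ _ P _ M (measurableT_comp mh (mT n))) => w; exact: hM.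
have i1 : L1 P (fun w => K ^- 2 * Z n w ^+ 2) by exact: L1Z.
have i2 : L1 P (fun w => d^-1 * q n w) by exact: L1Z.
have i3 : L1 P (fun w => d ^- 2 * (psi n w - v) ^+ 2) by exact: L1Z.
have i12 := L1D i1 i2.
have i123 := L1D i12 i3.
have i4 := L1Z (2 * M) i123.
have key : `|Ex P (h \o T n) - Ex P (h \o Z n)| <=
    e + 2 * M * (K ^- 2 * Ex P (fun w => Z n w ^+ 2) + d^-1 * Ex P (q n) +
      d ^- 2 * Ex P (fun w => (psi n w - v) ^+ 2)).
  rewrite -ExB// -!ExZ// -ExD// -ExD// -ExZ// -[X in X + _](Ex_cst P e) -ExD//; last exact: L1_cst.
  apply: Ex_norm_le.
  - by apply: (@measurable_L1 _ _ _ P); exact: L1B.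
  - by apply: L1D => //; exact: L1_cst.
  move=> w /=; have [a b] := Qq n w n0.
  apply: le_trans (dP _ (Z n w) (q n w) (Q n w) (psi n w) a b (TE n w n0)) _.
  by rewrite !(mulrC _^-1).
have b1 : 2 * M * (K ^- 2 * Ex P (fun w => Z n w ^+ 2)) <= e.
  apply: (@le_trans _ _ (2 * M * (K ^- 2 * C))).
    by rewrite ler_wpM2l ?mulr_ge0// ler_wpM2l// invr_ge0 sqr_ge0.
  rewrite mulrCA mulrC ler_pdivrMr ?exprn_gt0//.
  apply: (@le_trans _ _ (e * K)).
    have -> : e * K = e + 2 * M * C by rewrite /K; field; rewrite gt_eqF.
    by rewrite lerDr ltW.
  by rewrite ler_wpM2l ?(ltW e0)// expr2 ler_peMl// ltW.
have MM : 2 * M <= 2 * (M + 1) by rewrite ler_wpM2l// lerDl.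
have b2 : 2 * M * (d^-1 * Ex P (q n)) <= e.
  apply: (@le_trans _ _ (2 * M * (d^-1 * e1))).
    by rewrite ler_wpM2l ?mulr_ge0// ler_wpM2l// invr_ge0 ltW.
  have -> : d^-1 * e1 = e / (2 * (M + 1)) by rewrite /e1; field; rewrite !gt_eqF// ltr_wpDl.
  by rewrite mulrCA ler_piMr ?(ltW e0)// ler_pdivrMr// mul1r.
have b3 : 2 * M * (d ^- 2 * Ex P (fun w => (psi n w - v) ^+ 2)) <= e.
  apply: (@le_trans _ _ (2 * M * (d ^- 2 * e2))).
    by rewrite ler_wpM2l ?mulr_ge0// ler_wpM2l// invr_ge0 sqr_ge0.
  have -> : d ^- 2 * e2 = e / (2 * (M + 1)) by rewrite /e2; field; rewrite !gt_eqF// ltr_wpDl.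
  by rewrite mulrCA ler_piMr ?(ltW e0)// ler_pdivrMr// mul1r.
rewrite distrC in key; rewrite -(subrKA (Ex P (h \o Z n))).
apply: le_trans (ler_normD _ _) _.
apply: le_trans (lerD h3 key) _.
have -> : eta = 5 * e by rewrite /e; field.
by move: b1 b2 b3; rewrite !mulrDr; lra.
Unshelve. all: by end_near. Qed.

End slutsky.

(** * Conditional expectations *)

Section unconditional_integrals.
Context {R : realType} {dO : measure_display} {Omega : measurableType dO}
  (P : probability Omega R).

(* [fine] sends an infinite integral to [0]. *)
Lemma Rintegral_nonintegrable (G : Omega -> R) :
  measurable_fun setT G -> ~ L1 P G -> Ex P G = 0.
Proof.
move=> mG nG; rewrite /Ex /Rintegral integralE.
have mEG : measurable_fun setT (fun w => (G w)%:E) by exact/measurable_EFinP.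
have p0 : (0 <= \int[P]_x (fun w => (G w)%:E)^\+ x)%E by exact: integral_ge0.
have n0 : (0 <= \int[P]_x (fun w => (G w)%:E)^\- x)%E by exact: integral_ge0.
have : (\int[P]_x (fun w => (G w)%:E)^\+ x + \int[P]_x (fun w => (G w)%:E)^\- x = +oo)%E.
  rewrite -ge0_integralD//; last 2 first.
  - exact: measurable_funepos.
  - exact: measurable_funeneg.
  apply/eqP; rewrite -leye_eq leNgt; apply/negP => H; apply: nG.
  apply/integrableP; split => //; apply: le_lt_trans H.
  rewrite le_eqVlt; apply/orP; left; apply/eqP; apply: eq_integral => w _.
  by rewrite -[LHS]/((abse \o (fun w => (G w)%:E)) w) fune_abse.
case: (\int[P]_x _)%E p0 => [a||] //; case: (\int[P]_x _)%E n0 => [b||] //.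
Qed.

(* Unlike [ExZ], usable for every fixed [x] in an inner integral, which may fail to
   exist on a null set of [x]. *)
Lemma ExZ_measurable (c : R) (G : Omega -> R) : measurable_fun setT G ->
  Ex P (fun w => c * G w) = c * Ex P G.
Proof.
move=> mG; have [iG|iG] := pselect (L1 P G); first exact: ExZ.
have [->|c0] := eqVneq c 0.
  by under eq_fun do rewrite mul0r; rewrite Ex_cst mul0r.
rewrite (Rintegral_nonintegrable mG iG) mulr0 Rintegral_nonintegrable//.
  exact: measurable_funM.
move=> icG; apply: iG; have := L1Z c^-1 icG.
by under eq_fun do rewrite mulKf//.
Qed.

(** If one side fails to be integrable then so does the other, and both means are [0] by convention;
    this makes the identity available for every slice. *)
Lemma same_law_Ex {d : measure_display} {T : measurableType d}
    (X1 X2 : Omega -> T) (g : T -> R) :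
  measurable_fun setT X1 -> measurable_fun setT X2 -> measurable_fun setT g ->
  same_law P X1 X2 -> Ex P (g \o X1) = Ex P (g \o X2).
Proof.
move=> mX1 mX2 mg X12; have [i1|i1] := pselect (L1 P (g \o X1)).
  by have [] := same_law_integral mX1 mX2 mg X12 i1.
rewrite !Rintegral_nonintegrable//; first exact: (measurableT_comp mg).
- move=> i2; apply: i1.
  have X21 : same_law P X2 X1 by move=> A mA; rewrite X12.
  by have [] := same_law_integral mX2 mX1 mg X21 i2.
- exact: (measurableT_comp mg).
Qed.

(** Both joint laws are the product of the law of [X1] with the common law of [X2] and [X3]. *)
Lemma independent2_same_law {d1 d2 : measure_display} {T1 : measurableType d1}
    {T2 : measurableType d2} (X1 : Omega -> T1) (X2 X3 : Omega -> T2) :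
  measurable_fun setT X1 -> measurable_fun setT X2 -> measurable_fun setT X3 ->
  independent2 P X1 X2 -> independent2 P X1 X3 -> same_law P X2 X3 ->
  same_law P (fun w => (X1 w, X2 w)) (fun w => (X1 w, X3 w)).
Proof.
move=> mX1 mX2 mX3 i12 i13 l23 A mA.
pose Y1 : {mfun Omega >-> T1} := HB.pack X1 (isMeasurableFun.Build _ _ _ _ _ mX1).
pose Y3 : {mfun Omega >-> T2} := HB.pack X3 (isMeasurableFun.Build _ _ _ _ _ mX3).
have mj (X : Omega -> T2) : measurable_fun setT X ->
    measurable_fun setT (fun w => (X1 w, X w)) by move=> mX; exact: measurable_fun_pair.
pose j2 : {mfun Omega >-> (T1 * T2)%type} :=
  HB.pack (fun w => (X1 w, X2 w)) (isMeasurableFun.Build _ _ _ _ _ (mj _ mX2)).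
pose j3 : {mfun Omega >-> (T1 * T2)%type} :=
  HB.pack (fun w => (X1 w, X3 w)) (isMeasurableFun.Build _ _ _ _ _ (mj _ mX3)).
transitivity ((distribution P Y1 \x distribution P Y3) A)%E.
  apply/esym; apply: (@product_measure_unique _ _ _ _ _ (distribution P Y1)
    (distribution P Y3) (distribution P j2)) => // B C mB mC.
  by rewrite -[RHS]/(P (X1 @^-1` B) * P (X3 @^-1` C))%E -l23// -i12.
exact: (@product_measure_unique _ _ _ _ _ (distribution P Y1)
    (distribution P Y3) (distribution P j3)).
Qed.

End unconditional_integrals.

Section conditional_expectation_unique.
Context {R : realType} {dO : measure_display} {Omega : measurableType dO}
  (P : probability Omega R) {d : measure_display} {T : measurableType d}
  (X : Omega -> T) (mX : measurable_fun setT X).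

(** The difference integrates to [0] over every set of the sub-sigma-algebra, in particular over the
    set where [Z1 >= Z2] and over its complement; hence its absolute value has integral [0]. *)
Lemma cond_expectation_unique (Y Z1 Z2 : Omega -> R) :
  is_cond_expectation P (g_sigma_algebra_preimage X) Y Z1 ->
  is_cond_expectation P (g_sigma_algebra_preimage X) Y Z2 ->
  ae_eq P setT (fun w => (Z1 w)%:E) (fun w => (Z2 w)%:E).
Proof.
move=> [i1 m1 e1] [i2 m2 e2].
(* [Omega] is equipped with the sigma-algebra generated by [X], so that the usual rules on
   measurable functions show that the sign of [Z1 - Z2] is measurable for it. *)
pose GT := g_sigma_algebra_preimageType X.
have mG (Z : Omega -> R) : (forall B : set R, measurable B ->
    g_sigma_algebra_preimage X (Z @^-1` B)) -> measurable_fun (setT : set GT) Z.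
  by move=> h _ B mB; rewrite setTI; exact: h.
have mD : measurable_fun (setT : set GT) (fun w => Z1 w - Z2 w).
  by apply: measurable_funB; exact: mG.
have Gm (A : set Omega) : g_sigma_algebra_preimage X A -> measurable A.
  by move=> [B mB <-]; exact: mX.
pose A := [set w | 0 <= Z1 w - Z2 w].
have GA : g_sigma_algebra_preimage X A.
  have -> : A = (fun w => Z1 w - Z2 w) @^-1` `[0, +oo[%classic.
    by apply/seteqP; split=> w; rewrite /A/= in_itv/= andbT.
  by rewrite -[X in _ X]setTI; apply: mD.
have GAC : g_sigma_algebra_preimage X (~` A) by exact: (@measurableC _ GT).
have mA := Gm _ GA.
have iD : P.-integrable setT (fun w => (Z1 w - Z2 w)%:E) by exact: (L1B i1 i2).
have zero (U V : Omega -> R) B : is_cond_expectation P (g_sigma_algebra_preimage X) Y U ->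
    is_cond_expectation P (g_sigma_algebra_preimage X) Y V ->
    g_sigma_algebra_preimage X B -> (\int[P]_(w in B) (U w - V w)%:E = 0)%E.
  move=> [iU _ eU] [iV _ eV] GB; have mB := Gm _ GB.
  have jU : P.-integrable B (fun w => (U w)%:E) by exact: integrableS iU.
  have jV : P.-integrable B (fun w => (V w)%:E) by exact: integrableS iV.
  under eq_integral do rewrite EFinB.
  rewrite integralB// eU// eV// subee//.
  by rewrite -eV//; exact: (integrable_fin_num mB jV).
have abs0 : (\int[P]_w `|(Z1 w - Z2 w)%:E| = 0)%E.
  rewrite -(setUv A) ge0_integral_setU//; last 3 first.
  - exact: measurableC.
  - rewrite setUv; apply: measurableT_comp => //.
    exact: measurable_int iD.
  - by apply/disj_setPS; rewrite setICr.
  rewrite -[RHS](adde0 0%E); congr (_ + _)%E.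
    rewrite -[RHS](zero Z1 Z2 A)//; apply: eq_integral => w /set_mem wA.
    by rewrite gee0_abs.
  rewrite -[RHS](zero Z2 Z1 (~` A))//; apply: eq_integral => w /set_mem /negP.
  by rewrite -ltNge => wA; rewrite lte0_abs// -EFinN opprB.
have := (ae_eq_integral_abs P measurableT (measurable_int _ iD)).1 abs0.
apply: filterS => w h _; have /= := h I.
by move=> /eqP; rewrite eqe subr_eq0 => /eqP ->.
Qed.

End conditional_expectation_unique.

(** * Pick and Freeze *)

Section merging.
Context {p : nat} {d : 'I_p -> measure_display} (E : forall i, measurableType (d i)).

Lemma measurable_subvector (u : {set 'I_p}) :
  measurable_fun setT (subvector u : product_space E -> subproduct E u).
Proof.
by apply: measurable_to_product_space => j; exact: measurable_coordinate.
Qed.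

Lemma measurable_pf_merge (u : {set 'I_p}) :
  measurable_fun setT (fun z : subproduct E u * subproduct E (~: u)%SET => pf_merge z.1 z.2).
Proof.
apply: measurable_to_product_space => j; rewrite /pf_merge.
destruct (boolP (j \in u)) as [ju|ju].
  exact: (measurableT_comp (@measurable_coordinate _ _
    (fun i : {i : 'I_p | i \in u} => E (sval i)) (exist _ j ju)) measurable_fst).
exact: (measurableT_comp (@measurable_coordinate _ _
    (fun i : {i : 'I_p | i \in (~: u)%SET} => E (sval i)) (exist _ j (mem_compl ju))) measurable_snd).
Qed.

Lemma pf_merge_subvector (u : {set 'I_p}) (x : product_space E) :
  pf_merge (subvector u x) (subvector (~: u)%SET x) = x.
Proof.
apply: functional_extensionality_dep => j; rewrite /pf_merge /subvector.
by destruct (boolP (j \in u)).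
Qed.

End merging.

Section pick_freeze.
Context {R : realType} {dO : measure_display} {Omega : measurableType dO}
  (P : probability Omega R) {p : nat} {d : 'I_p -> measure_display}
  {E : forall i : 'I_p, measurableType (d i)}
  (X : forall i : 'I_p, {RV P >-> E i}) (u : {set 'I_p})
  (X' : {RV P >-> subproduct E (~: u)%SET}).
Hypotheses (iX : mutually_independent P X)
  (lX' : same_law P X' (subvector (~: u)%SET \o input X))
  (iX' : independent2 P (input X) X').

Let A : Omega -> subproduct E u := subvector u \o input X.
Let B : Omega -> subproduct E (~: u)%SET := subvector (~: u)%SET \o input X.
Let merged (z : subproduct E u * subproduct E (~: u)%SET) := pf_merge z.1 z.2.

Lemma measurable_input : measurable_fun setT (input X).
Proof. by apply: measurable_to_product_space => j; exact: measurable_funP. Qed.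

Let mA : measurable_fun setT A.
Proof. exact: (measurableT_comp (@measurable_subvector _ _ E u) measurable_input). Qed.

Let mB : measurable_fun setT B.
Proof. exact: (measurableT_comp (@measurable_subvector _ _ E (~: u)%SET) measurable_input). Qed.

Let mX' : measurable_fun setT X'. Proof. exact: measurable_funP. Qed.

Let iAB : independent2 P A B.
Proof.
have q12 (i : 'I_p) : i \in u -> ~~ (i \in (~: u)%SET) by rewrite finset.in_setC negbK.
exact: (mutually_independent_blocks (q1 := fun i => i \in u)
  (q2 := fun i => i \in (~: u)%SET) (fun i => measurable_funP (X i)) q12 iX).
Qed.

Let iAX' : independent2 P A X'.
Proof. exact: (independent2_comp (@measurable_subvector _ _ E u) (@measurable_id _ _ setT) iX'). Qed.

Definition frozen_copy (w : Omega) : product_space E :=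
  pf_merge (subvector u (input X w)) (X' w).

Lemma measurable_frozen_copy : measurable_fun setT frozen_copy.
Proof.
apply: (measurableT_comp (@measurable_pf_merge _ _ E u)
  (_ : measurable_fun setT (fun w => (A w, X' w)))).
exact: measurable_fun_pair.
Qed.

(** [X_u] is independent both of the remaining inputs and of [X'], which have the same law, so the
    two pairs have the same law; [pf_merge] then carries them to [input X] and to [frozen_copy]. *)
Lemma same_law_frozen_copy : same_law P (input X) frozen_copy.
Proof.
have lBX' : same_law P B X' by move=> S mS; rewrite lX'.
have := independent2_same_law mA mB mX' iAB iAX' lBX'.
move=> H S mS.
have mS' : measurable (merged @^-1` S).
  by rewrite -[X in measurable X]setTI; exact: measurable_pf_merge.
have e : (fun w => (A w, B w)) @^-1` (merged @^-1` S) = input X @^-1` S.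
  by apply/seteqP; split=> w; rewrite /A /B /merged/= pf_merge_subvector.
by rewrite -e; exact: H mS'.
Qed.

Section component.
Variable phi : product_space E -> R.
Hypotheses (mphi : measurable_fun setT phi) (phi2 : L2 P (phi \o input X)).

Let g (x : subproduct E u) : R := Ex P (fun w => phi (pf_merge x (X' w))).

Let mmerged : measurable_fun setT merged. Proof. exact: measurable_pf_merge. Qed.

Let mphim : measurable_fun setT (phi \o merged).
Proof. exact: (measurableT_comp mphi mmerged). Qed.

Let mslice (x : subproduct E u) : measurable_fun setT (fun y => phi (merged (x, y))).
Proof.
apply: (measurableT_comp mphim); exact: measurable_pair1.
Qed.

Let gB x : Ex P (fun w => phi (merged (x, B w))) = g x.
Proof.
have lBX' : same_law P B X' by move=> S mS; rewrite lX'.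
exact: (same_law_Ex mB mX' (mslice x) lBX').
Qed.

Let copy2 : L2 P (phi \o frozen_copy).
Proof.
have [_ i2] := phi2; have mc := measurable_frozen_copy.
split; first exact: (measurableT_comp mphi mc).
have msq : measurable_fun setT (fun x => phi x ^+ 2) by exact: measurable_funX.
by have [] := same_law_integral measurable_input mc msq same_law_frozen_copy i2.
Qed.

Let Z w := g (A w).

Let mg : measurable_fun setT g.
Proof. exact: (measurable_frozen_mean mA mX' iAX' mphim (L2_L1 copy2)). Qed.

Let iZ : L1 P Z.
Proof. exact: (integrable_frozen_mean mA mX' iAX' mphim (L2_L1 copy2)). Qed.

Let mergedAB w : merged (A w, B w) = input X w.
Proof. exact: pf_merge_subvector. Qed.

(** The whole input is frozen, being independent of [X']: at [x], the mean over [X'] of the product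
    of the two outputs is [phi x * g (subvector u x)]. *)
Let iYZ : L1 P (fun w => phi (input X w) * Z w) /\
  Ex P (fun w => phi (input X w) * phi (frozen_copy w)) =
  Ex P (fun w => phi (input X w) * Z w).
Proof.
pose F (z : product_space E * subproduct E (~: u)%SET) : R :=
  phi z.1 * phi (merged (subvector u z.1, z.2)).
have mF : measurable_fun setT F.
  apply: measurable_funM; first exact: (measurableT_comp mphi measurable_fst).
  apply: (measurableT_comp mphim); apply: measurable_fun_pair => //.
  exact: (measurableT_comp (@measurable_subvector _ _ E u) measurable_fst).
have iF : L1 P (fun w => F (input X w, X' w)) by exact: L2M.
have mean x : frozen_mean P X' F x = phi x * g (subvector u x).
  exact: (ExZ_measurable P (phi x) (measurableT_comp (mslice (subvector u x)) mX')).
split.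
  have := integrable_frozen_mean measurable_input mX' iX' mF iF.
  by apply: eq_integrable => // w _; rewrite /= mean.
rewrite /Ex (integral_frozen_mean measurable_input mX' iX' mF iF).
by apply: eq_Rintegral => w _; rewrite mean.
Qed.

(** Now only [X_u] is frozen, the other inputs being independent of it: the mean of
    [g x * phi (merged (x, B))] is [g x ^+ 2]. Integrability of frozen means gives the square
    integrability of [Z] as a by-product, in place of Jensen's inequality. *)
Let iZZ : L2 P Z /\
  Ex P (fun w => phi (input X w) * Z w) = Ex P (fun w => Z w ^+ 2).
Proof.
have [iYZ' _] := iYZ.
pose F (z : subproduct E u * subproduct E (~: u)%SET) : R := g z.1 * phi (merged z).
have mF : measurable_fun setT F.
  by apply: measurable_funM => //; exact: (measurableT_comp mg measurable_fst).
have FE w : F (A w, B w) = phi (input X w) * Z w by rewrite /F mergedAB mulrC.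
have iF : L1 P (fun w => F (A w, B w)) by under eq_fun do rewrite FE.
have mean x : frozen_mean P B F x = g x ^+ 2.
  rewrite expr2 -[X in _ = _ * X]gB.
  exact: (ExZ_measurable P (g x) (measurableT_comp (mslice x) mB)).
split.
  split; first exact: (measurableT_comp mg mA).
  have := integrable_frozen_mean mA mB iAB mF iF.
  by apply: eq_integrable => // w _; rewrite /= mean.
under eq_fun do rewrite -FE.
rewrite /Ex (integral_frozen_mean mA mB iAB mF iF).
by apply: eq_Rintegral => w _; rewrite mean.
Qed.

(** A set of the sub-sigma-algebra is the event that [X_u] lies in some [C], so its indicator is
    constant once [X_u] is frozen and comes out of the mean, leaving [\1_C x * g x]. *)
Let Z_version :
  is_cond_expectation P (g_sigma_algebra_preimage A) (phi \o input X) Z.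
Proof.
split; first exact: iZ.
  move=> S mS; exists (g @^-1` S); last by rewrite setTI.
  by rewrite -[X in measurable X]setTI; exact: mg.
move=> _ [C mC <-]; rewrite setTI.
have mAC : measurable (A @^-1` C) by rewrite -[X in measurable X]setTI; exact: mA.
pose F (z : subproduct E u * subproduct E (~: u)%SET) : R := \1_C z.1 * phi (merged z).
have mF : measurable_fun setT F.
  by apply: measurable_funM => //; apply: (measurableT_comp _ measurable_fst); exact: measurable_indic.
have i1 w : `|\1_C (A w) : R| <= 1 by rewrite indicE; case: (_ \in _); rewrite ?normr1 ?normr0.
have m1 : measurable_fun setT (fun w => \1_C (A w) : R).
  by apply: (measurableT_comp _ mA); exact: measurable_indic.
have iphi : L1 P (fun w => phi (input X w) * \1_C (A w)) := L1M_bounded (L2_L1 phi2) m1 i1.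
have FE w : F (A w, B w) = phi (input X w) * \1_C (A w) by rewrite /F mergedAB mulrC.
have iF : L1 P (fun w => F (A w, B w)) by under eq_fun do rewrite FE.
have mean x : frozen_mean P B F x = \1_C x * g x.
  rewrite -gB.
  exact: (ExZ_measurable P (\1_C x) (measurableT_comp (mslice x) mB)).
have restrict (G : Omega -> R) : L1 P (fun w => G w * \1_C (A w)) ->
    (\int[P]_(w in A @^-1` C) (G w)%:E)%E = (Ex P (fun w => G w * \1_C (A w)))%:E.
  move=> iG; rewrite /Ex /Rintegral fineK; last exact: (integrable_fin_num measurableT iG).
  rewrite [LHS]integral_mkcond; apply: eq_integral => w _.
  rewrite patchE indicE /=; case: ifPn => [/set_mem wC|wC].
    by rewrite mem_set// mulr1.
  rewrite (_ : A w \in C = false) ?mulr0//; apply/negbTE; apply: contra wC => wC.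
  by rewrite inE/=; exact: set_mem.
rewrite (restrict _ (L1M_bounded iZ m1 i1)) (restrict _ iphi); congr EFin.
transitivity (Ex P (fun w => F (A w, B w))); last first.
  by congr Ex; apply/funext => w; rewrite FE.
rewrite [RHS]/Ex (integral_frozen_mean mA mB iAB mF iF).
by apply: eq_Rintegral => w _; rewrite mean mulrC.
Qed.

Lemma cov_cond_expectation :
  let W := cond_expectation P (g_sigma_algebra_preimage (subvector u \o input X))
    (phi \o input X) in
  cov P W W =
  Ex P (fun w => phi (input X w) * phi (frozen_copy w)) - Ex P (phi \o input X) ^+ 2.
Proof.
move=> W.
have W_version : is_cond_expectation P (g_sigma_algebra_preimage A) (phi \o input X) W.
  (* [Z] proves that a version exists, so the chosen [W] is one as well; uniqueness then moves its
     covariance to [Z]. *)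
  by apply: (@xgetPex _ (fun=> 0)); exists Z; exact: Z_version.
have [iW _ eW] := W_version.
have WZ := cond_expectation_unique mA W_version Z_version.
have [Z2 EYZ] := iZZ; have [_ EYY] := iYZ.
have mW := measurable_L1 iW; have [mZ iZ2] := Z2.
have GT : g_sigma_algebra_preimage A setT.
  by exists setT => //; rewrite preimage_setT setTI.
have EW : Ex P W = Ex P (phi \o input X) by rewrite /Ex /Rintegral eW.
have EZ : Ex P Z = Ex P (phi \o input X).
  by have [_ _ eZ] := Z_version; rewrite /Ex /Rintegral eZ.
rewrite covE EYY EYZ EW.
set m := Ex P (phi \o input X) in EZ *.
have -> : Ex P (fun w => (W w - m) * (W w - m)) = Ex P (fun w => (Z w - m) * (Z w - m)).
  congr fine; apply: ae_eq_integral => //.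
  - apply/measurable_EFinP; apply: measurable_funM; exact: measurable_funB.
  - apply/measurable_EFinP; apply: measurable_funM; exact: measurable_funB.
  - by apply: filterS WZ => w h _; have [->] := h I.
have -> : (fun w => (Z w - m) * (Z w - m)) = (fun w => Z w ^+ 2 - 2 * m * Z w + m ^+ 2).
  by apply/funext => w; ring.
rewrite ExD ?Ex_cst; last 2 first.
- by apply: L1B => //; exact: L1Z.
- exact: L1_cst.
by rewrite ExB ?ExZ ?EZ//; [ring|exact: L1Z].
Qed.

End component.
End pick_freeze.

(** * Asymptotics of the estimator *)

Section iid_images.
Context {R : realType} {dO : measure_display} {Omega : measurableType dO}
  (P : probability Omega R).

Lemma mutually_independent_comp {I : choiceType} {d : measure_display}
    {T : measurableType d} (W : I -> Omega -> T) (g : T -> R) :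
  measurable_fun setT g -> mutually_independent P W ->
  mutually_independent P (fun i => g \o W i).
Proof.
move=> mg iW J A mA; have := iW J (fun i => g @^-1` A i).
apply=> i iJ; rewrite -[X in measurable X]setTI; apply: mg => //; exact: mA.
Qed.

Lemma sum_cov (n : nat) (F G : 'I_n -> Omega -> R) :
  (forall l, L2 P (F l)) -> (forall l, L2 P (G l)) ->
  \sum_(l < n) \sum_(l' < n) cov P (F l) (G l') =
  Ex P (fun w => (\sum_(l < n) (F l w - Ex P (F l))) *
                 (\sum_(l < n) (G l w - Ex P (G l)))).
Proof.
move=> F2 G2.
have FG l l' : L1 P (fun w => (F l w - Ex P (F l)) * (G l' w - Ex P (G l'))).
  by apply: L2M; apply: L2B => //; exact: L2_cst.
have -> : (fun w => (\sum_(l < n) (F l w - Ex P (F l))) * (\sum_(l < n) (G l w - Ex P (G l)))) =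
    (fun w => \sum_(l < n) \sum_(l' < n) (F l w - Ex P (F l)) * (G l' w - Ex P (G l'))).
  by apply/funext => w; rewrite big_distrlr.
rewrite Ex_sum; last by move=> l; exact: L1_sum.
apply: eq_bigr => l _; rewrite Ex_sum//.
by apply: eq_bigr => l' _; rewrite covE.
Qed.

(** Only the combination is assumed centered, not its parts: subtracting the zero mean centers every
    [F l] and [G l] at once, and bilinearity produces the covariance sums of [sigma^2]. *)
Lemma Ex_sqr_lincomb (n : nat) (F G : 'I_n -> Omega -> R) (a b : R) :
  (forall l, L2 P (F l)) -> (forall l, L2 P (G l)) ->
  a * (\sum_(l < n) Ex P (F l)) + b * (\sum_(l < n) Ex P (G l)) = 0 ->
  Ex P (fun w => (a * (\sum_(l < n) F l w) + b * (\sum_(l < n) G l w)) ^+ 2) =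
  a ^+ 2 * (\sum_(l < n) \sum_(l' < n) cov P (F l) (F l'))
    + b ^+ 2 * (\sum_(l < n) \sum_(l' < n) cov P (G l) (G l'))
    + 2 * a * b * (\sum_(l < n) \sum_(l' < n) cov P (F l) (G l')).
Proof.
move=> F2 G2 m0; rewrite !sum_cov//.
have cent (H : 'I_n -> Omega -> R) : (forall l, L2 P (H l)) ->
    L2 P (fun w => \sum_(l < n) (H l w - Ex P (H l))).
  by move=> H2; apply: L2_sum => l; apply: L2B => //; exact: L2_cst.
have cF := cent _ F2; have cG := cent _ G2.
have iFF := L2M cF cF; have iGG := L2M cG cG; have iFG := L2M cF cG.
rewrite -!ExZ// -ExD; [|exact: L1Z|exact: L1Z].
rewrite -ExD; [|by apply: L1D; exact: L1Z|exact: L1Z].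
congr Ex; apply/funext => w; rewrite !sumrB.
set f := \sum_(l < n) F l w; set g := \sum_(l < n) G l w.
have -> : a * f + b * g = a * (f - \sum_(l < n) Ex P (F l)) + b * (g - \sum_(l < n) Ex P (G l)).
  by rewrite -[LHS]subr0 -[X in _ - X]m0; ring.
by ring.
Qed.

Lemma L2_mul_sqr (x y : Omega -> R) : measurable_fun setT x -> measurable_fun setT y ->
  L2 P (fun w => x w ^+ 2) -> L2 P (fun w => y w ^+ 2) ->
  L2 P (fun w => x w * y w).
Proof.
move=> mx my x4 y4; split; first exact: measurable_funM.
by under eq_fun do rewrite exprMn; exact: L2M.
Qed.

End iid_images.

Section empirical.
Context {R : realType}.

(* The estimator is invariant under translation of the sample. *)
Lemma empirical_centering (n : nat) (y z : 'I_n -> R) (m : R) : (0 < n)%N ->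
  let mean := n%:R^-1 * \sum_i ((y i + z i) / 2) in
  let cmean := n%:R^-1 * \sum_i ((y i - m + (z i - m)) / 2) in
  n%:R^-1 * \sum_i (y i * z i) - mean ^+ 2 =
    n%:R^-1 * \sum_i ((y i - m) * (z i - m)) - cmean ^+ 2 /\
  n%:R^-1 * \sum_i ((y i ^+ 2 + z i ^+ 2) / 2) - mean ^+ 2 =
    n%:R^-1 * \sum_i (((y i - m) ^+ 2 + (z i - m) ^+ 2) / 2) - cmean ^+ 2.
Proof.
move=> n0 mean cmean.
have nn : n%:R != 0 :> R by rewrite pnatr_eq0 -lt0n.
have cst (c : R) : \sum_(i < n) c = n%:R * c by rewrite sumr_const card_ord mulr_natl.
have cE : cmean = mean - m.
  rewrite /cmean /mean -[X in _ - X](mulKf nn m) -mulrBr -cst -sumrB.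
  by congr (_ * _); apply: eq_bigr => i _; field.
have shift (A B : 'I_n -> R) :
    (forall i, B i = A i - 2 * m * ((y i + z i) / 2) + m ^+ 2) ->
    n%:R^-1 * \sum_i B i = n%:R^-1 * (\sum_i A i) - 2 * m * mean + m ^+ 2.
  move=> BE; under eq_bigr do rewrite BE.
  by rewrite big_split/= sumrB -mulr_sumr cst /mean; field.
rewrite cE; split.
  rewrite (shift (fun i => y i * z i) (fun i => (y i - m) * (z i - m))); last by move=> i /=; field.
  by ring.
rewrite (shift (fun i => (y i ^+ 2 + z i ^+ 2) / 2)
  (fun i => ((y i - m) ^+ 2 + (z i - m) ^+ 2) / 2)); last by move=> i /=; field.
by ring.
Qed.

End empirical.

(** Inversion is not continuous at [0]; it is rewritten through a power of the nonnegative number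
    [x ^+ 2]. At [0] both sides are [0]. *)
Lemma measurable_inv_fun (R : realType) : measurable_fun setT (fun x : R => x^-1).
Proof.
have -> : (fun x : R => x^-1) = (fun x => x * (x ^+ 2) `^ (- 1)).
  apply/funext => x; rewrite powR_inv1 ?sqr_ge0//.
  have [->|x0] := eqVneq x 0; first by rewrite invr0 mul0r.
  by rewrite expr2 invfM mulrA divff// mul1r.
apply: measurable_funM => //.
apply: (@measurableT_comp _ _ _ _ _ _ (fun t : R => t `^ (- 1))).
  exact: measurable_powR.
exact: measurable_funX.
Qed.

Section estimator_limit.
Context {R : realType} {dO : measure_display} {Omega : measurableType dO}
  (P : probability Omega R) {k : nat}.
Local Notation pair_type := (k.-tuple R * k.-tuple R)%type.
Variables (W : nat -> {RV P >-> pair_type}) (ref : Omega -> pair_type) (m : 'I_k -> R).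
Hypotheses (mref : measurable_fun setT ref)
  (iW : mutually_independent P W) (lW : forall i, same_law P (W i) ref).

Let y (l : 'I_k) (x : pair_type) : R := tnth x.1 l.
Let z (l : 'I_k) (x : pair_type) : R := tnth x.2 l.

Hypotheses (y4 : forall l, L2 P (fun w => y l (ref w) ^+ 2))
  (z4 : forall l, L2 P (fun w => z l (ref w) ^+ 2))
  (Ey : forall l, Ex P (fun w => y l (ref w)) = m l)
  (Ez : forall l, Ex P (fun w => z l (ref w)) = m l)
  (yz_var : forall l, Ex P (fun w => (z l (ref w) - m l) ^+ 2) =
    Ex P (fun w => (y l (ref w) - m l) ^+ 2)).

Let my l : measurable_fun setT (y l).
Proof. exact: (measurableT_comp (measurable_tnth l) measurable_fst). Qed.

Let mz l : measurable_fun setT (z l).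
Proof. exact: (measurableT_comp (measurable_tnth l) measurable_snd). Qed.

Let U (l : 'I_k) (x : pair_type) : R := (y l x - m l) * (z l x - m l).
Let V (l : 'I_k) (x : pair_type) : R := (y l x - m l) ^+ 2 + (z l x - m l) ^+ 2.
Let H (l : 'I_k) (x : pair_type) : R := (y l x - m l + (z l x - m l)) / 2.
Let psi (x : pair_type) : R := \sum_(l < k) V l x / 2.

Let myc l : measurable_fun setT (fun x => y l x - m l).
Proof. exact: measurable_funB. Qed.
Let mzc l : measurable_fun setT (fun x => z l x - m l).
Proof. exact: measurable_funB. Qed.
Let mU l : measurable_fun setT (U l).
Proof. by apply: measurable_funM. Qed.
Let mV l : measurable_fun setT (V l).
Proof. by apply: measurable_funD; exact: measurable_funX. Qed.
Let mH l : measurable_fun setT (H l).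
Proof. by apply: measurable_funM => //; exact: measurable_funD. Qed.
Let mpsi : measurable_fun setT psi.
Proof. by apply: measurable_sum => l; exact: measurable_funM. Qed.

Let y2 l : L2 P (fun w => y l (ref w)).
Proof. by split; [exact: (measurableT_comp (my l) mref)|exact: L2_L1 (y4 l)]. Qed.
Let z2 l : L2 P (fun w => z l (ref w)).
Proof. by split; [exact: (measurableT_comp (mz l) mref)|exact: L2_L1 (z4 l)]. Qed.

Let yc2 l : L2 P (fun w => y l (ref w) - m l).
Proof. by apply: L2B => //; exact: L2_cst. Qed.
Let zc2 l : L2 P (fun w => z l (ref w) - m l).
Proof. by apply: L2B => //; exact: L2_cst. Qed.

Let shifted_sqr (x : Omega -> R) (c : R) : L2 P x -> L2 P (fun w => x w ^+ 2) ->
  L2 P (fun w => (x w - c) ^+ 2).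
Proof.
move=> x2 x4.
have -> : (fun w => (x w - c) ^+ 2) = (fun w => x w ^+ 2 - 2 * c * x w + c ^+ 2).
  by apply/funext => w; ring.
by apply: L2D; [apply: L2B => //; exact: L2Z|exact: L2_cst].
Qed.

Let yc4 l : L2 P (fun w => (y l (ref w) - m l) ^+ 2). Proof. exact: shifted_sqr. Qed.
Let zc4 l : L2 P (fun w => (z l (ref w) - m l) ^+ 2). Proof. exact: shifted_sqr. Qed.

Let U2 l : L2 P (U l \o ref).
Proof.
apply: (L2_mul_sqr _ _ (yc4 l) (zc4 l)).
- exact: (measurableT_comp (myc l) mref).
- exact: (measurableT_comp (mzc l) mref).
Qed.
Let V2 l : L2 P (V l \o ref). Proof. exact: L2D (yc4 l) (zc4 l). Qed.
Let H2 l : L2 P (H l \o ref).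
Proof.
have := L2Z 2^-1 (L2D (yc2 l) (zc2 l)).
by under eq_fun do rewrite mulrC.
Qed.

Let v : R := \sum_(l < k) Ex P (fun w => (y l (ref w) - m l) ^+ 2).
Let num : R := \sum_(l < k) Ex P (U l \o ref).
Hypothesis v_gt0 : 0 < v.
Variables S a : R.
Hypotheses (SE : S = num / v) (aE : a = v^-1).
Let b := - (a / 2) * S.
Let phi (x : pair_type) : R := a * (\sum_(l < k) U l x) + b * (\sum_(l < k) V l x).

Let mphi : measurable_fun setT phi.
Proof.
by apply: measurable_funD; apply: measurable_funM => //; exact: measurable_sum.
Qed.

Let phi2 : L2 P (phi \o ref).
Proof. by apply: L2D; apply: L2Z; exact: L2_sum. Qed.

Let EV l : Ex P (V l \o ref) = 2 * Ex P (fun w => (y l (ref w) - m l) ^+ 2).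
Proof.
have [_ h1] := yc2 l; have [_ h2] := zc2 l.
by rewrite /V (ExD h1 h2) yz_var mulr_natl mulr2n.
Qed.

(** [V l] has mean twice the variance of the component, so the left-hand side is [num / v - S]. *)
Let centered : a * (\sum_(l < k) Ex P (U l \o ref)) + b * (\sum_(l < k) Ex P (V l \o ref)) = 0.
Proof.
under [X in _ + _ * X]eq_bigr do rewrite EV.
rewrite -mulr_sumr -/v -/num /b SE aE; field.
by rewrite gt_eqF.
Qed.

Let psi_centered : Ex P (psi \o ref) = v.
Proof.
rewrite (Ex_sum _ (X := fun l w => V l (ref w) / 2)).
  apply: eq_bigr => l _; have := L2_L1 (V2 l) => i.
  have -> : (fun w => V l (ref w) / 2) = (fun w => 2^-1 * V l (ref w)).
    by apply/funext => w; rewrite mulrC.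
  by rewrite ExZ// -[X in _ * X]/(Ex P (V l \o ref)) EV mulKf.
move=> l; have := L1Z 2^-1 (L2_L1 (V2 l)).
by under eq_fun do rewrite mulrC.
Qed.

Let psi2 : L2 P (psi \o ref).
Proof.
apply: (@L2_sum _ _ _ P _ _ (fun l w => V l (ref w) / 2)) => l.
have := L2Z 2^-1 (V2 l).
by under eq_fun do rewrite mulrC.
Qed.

(** * Scalar images of the iid sample *)

Section image.
Variable g : pair_type -> R.
Hypotheses (mg : measurable_fun setT g) (g2 : L2 P (g \o ref)).

Let mgW i : measurable_fun setT (g \o W i).
Proof. exact: (measurableT_comp mg (measurable_funP (W i))). Qed.

Lemma image_transfer i (h : R -> R) : measurable_fun setT h -> L1 P (h \o g \o ref) ->
  L1 P (h \o g \o W i) /\ Ex P (h \o g \o W i) = Ex P (h \o g \o ref).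
Proof.
move=> mh ih.
have l : same_law P ref (W i) by move=> A mA; rewrite lW.
have [h1 h2] := same_law_integral mref (measurable_funP (W i)) (measurableT_comp mh mg) l ih.
by split.
Qed.

Lemma image_same_law i : same_law P (g \o W i) (g \o W 0%N).
Proof.
move=> A mA.
have mgA : measurable (g @^-1` A) by rewrite -[X in measurable X]setTI; exact: mg.
transitivity (P (ref @^-1` (g @^-1` A))); first exact: lW.
by apply/esym; exact: lW.
Qed.

Lemma image_L2 i : L2 P (g \o W i).
Proof.
split; first exact: mgW.
have [_ i2] := g2.
have msq : measurable_fun setT (fun t : R => t ^+ 2) by exact: measurable_funX.
by have [] := image_transfer i msq i2.
Qed.

Lemma image_Ex i : Ex P (g \o W i) = Ex P (g \o ref).
Proof. by have [] := image_transfer i (@measurable_id _ R setT) (L2_L1 g2). Qed.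

Hypothesis g0 : Ex P (g \o ref) = 0.
Let ns := normalized_sum (fun i => g \o W i).

Lemma image_ns_L2 n : L2 P (ns n).
Proof. exact: L2_normalized_sum mgW image_same_law (image_L2 0%N) n. Qed.

Lemma image_ns_bound n : Ex P (fun w => ns n w ^+ 2) <= Ex P (fun w => g (W 0%N w) ^+ 2).
Proof.
apply: (Ex_sqr_normalized_sum mgW (mutually_independent_comp mg iW) image_same_law
  (image_L2 0%N)).
by rewrite image_Ex.
Qed.

Lemma image_clt (h : R -> R) (M : R) : continuous h -> (forall x, `|h x| <= M) ->
  Ex P (h \o ns n) @[n --> \oo] --> Ex (gaussian (Ex P (fun w => g (W 0%N w) ^+ 2))) h.
Proof.
move=> ch hM.
apply: (central_limit mgW (mutually_independent_comp mg iW) image_same_law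
  (image_L2 0%N) _ ch hM).
by rewrite image_Ex.
Qed.

End image.

Lemma nsE (g : pair_type -> R) n w :
  normalized_sum (fun i => g \o W i) n w =
  (Num.sqrt n%:R)^-1 * \sum_(i < n) g (W i w).
Proof. by []. Qed.

Let psic (x : pair_type) : R := psi x - v.
Let mpsic : measurable_fun setT psic. Proof. exact: measurable_funB. Qed.
Let psic2 : L2 P (psic \o ref).
Proof. by apply: L2B => //; exact: L2_cst. Qed.
Let psic0 : Ex P (psic \o ref) = 0.
Proof.
have -> : Ex P (psic \o ref) = Ex P (psi \o ref) - Ex P (fun=> v).
  by rewrite -ExB//; [exact: L2_L1 psi2|exact: L1_cst].
by rewrite psi_centered Ex_cst subrr.
Qed.

Let phi0 : Ex P (phi \o ref) = 0.
Proof.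
have iU : forall l, L1 P (fun w => U l (ref w)) by move=> l; exact: L2_L1 (U2 l).
have iV : forall l, L1 P (fun w => V l (ref w)) by move=> l; exact: L2_L1 (V2 l).
rewrite -[RHS]centered -!Ex_sum// -!ExZ//; [|exact: L1_sum|exact: L1_sum].
by rewrite -ExD//; apply: L1Z; exact: L1_sum.
Qed.

Let H0 l : Ex P (H l \o ref) = 0.
Proof.
have i1 := L2_L1 (yc2 l); have i2 := L2_L1 (zc2 l).
have -> : H l \o ref = (fun w => 2^-1 * ((y l (ref w) - m l) + (z l (ref w) - m l))).
  by apply/funext => w; rewrite /= /H mulrC.
rewrite ExZ ?ExD ?ExB ?Ex_cst ?Ey ?Ez ?subrr ?addr0 ?mulr0//.
- exact: L2_L1 (z2 l).
- exact: L1_cst.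
- exact: L2_L1 (y2 l).
- exact: L1_cst.
- exact: L1D.
Qed.

Let Z := normalized_sum (fun i => phi \o W i).
Let hn l := normalized_sum (fun i => H l \o W i).
(** For [n > 0] this is [sqrt n * Q n] (see [qE]). The form chosen here shows the factor
    [1 / sqrt n] in front of squares with bounded mean, hence the convergence of its mean to [0]. *)
Let q (n : nat) (w : Omega) : R := \sum_(l < k) (Num.sqrt n%:R)^-1 * hn l n w ^+ 2.
Let Q (n : nat) (w : Omega) : R := \sum_(l < k) (n%:R^-1 * \sum_(i < n) H l (W i w)) ^+ 2.
Let psin (n : nat) (w : Omega) : R := n%:R^-1 * \sum_(i < n) psi (W i w).
Let T (n : nat) (w : Omega) : R := Num.sqrt n%:R * (estimator W n w - S).

Let mT n : measurable_fun setT (T n).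
Proof.
have mi (g : pair_type -> R) : measurable_fun setT g -> forall i,
    measurable_fun setT (fun w => g (W i w)).
  by move=> mg i; exact: (measurableT_comp mg (measurable_funP (W i))).
have msum (g : pair_type -> R) : measurable_fun setT g ->
    measurable_fun setT (fun w => n%:R^-1 * \sum_(i < n) g (W i w)).
  by move=> mg; apply: measurable_funM => //; apply: measurable_sum => i; exact: mi.
have mmean l : measurable_fun setT (fun w => (n%:R^-1 *
    \sum_(i < n) ((tnth (W i w).1 l + tnth (W i w).2 l) / 2)) ^+ 2).
  apply: measurable_funX; apply: (msum (fun x => (y l x + z l x) / 2)).
  by apply: measurable_funM => //; exact: measurable_funD.
apply: measurable_funM => //; apply: measurable_funB => //.
apply: measurable_funM.
  apply: measurable_sum => l; apply: measurable_funB => //.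
  by apply: (msum (fun x => y l x * z l x)); exact: measurable_funM.
apply: (measurableT_comp (@measurable_inv_fun R)) => /=.
apply: measurable_sum => l; apply: measurable_funB => //.
apply: (msum (fun x => (y l x ^+ 2 + z l x ^+ 2) / 2)).
by apply: measurable_funM => //; apply: measurable_funD; exact: measurable_funX.
Qed.

Let r (n : nat) : R := (Num.sqrt n%:R)^-1.

Let r_ge0 n : 0 <= r n. Proof. by rewrite invr_ge0. Qed.

Let r_sqr n : r n * r n = n%:R^-1.
Proof. by rewrite -invfM -expr2 sqr_sqrtr. Qed.

Let r_le1 n : (0 < n)%N -> r n <= 1.
Proof.
move=> n0; rewrite invf_le1 ?sqrtr_gt0 ?ltr0n//.
by rewrite -[leLHS]sqrtr1 ler_sqrt ?ler1n.
Qed.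

Let cvg_r : r n @[n --> \oo] --> (0 : R). Proof. exact: cvg_invsqrt. Qed.

Let h2 l n : L2 P (hn l n). Proof. exact: image_ns_L2. Qed.

Let iq n : L1 P (q n).
Proof. by apply: L1_sum => l; apply: L1Z; case: (h2 l n). Qed.

Let q_cvg : Ex P (q n) @[n --> \oo] --> (0 : R).
Proof.
pose C := \sum_(l < k) Ex P (fun w => H l (W 0%N w) ^+ 2).
have rC : r n * C @[n --> \oo] --> (0 : R).
  by rewrite -(mul0r C); apply: cvgMl; exact: cvg_r.
apply: (squeeze_cvgr _ (cvg_cst 0) rC); apply: nearW => n.
rewrite Ex_ge0 /=; last by move=> w; apply: sumr_ge0 => l _; rewrite mulr_ge0 ?sqr_ge0.
rewrite /q (Ex_sum _ (X := fun l w => (Num.sqrt n%:R)^-1 * hn l n w ^+ 2)); last first.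
  by move=> l; apply: L1Z; case: (h2 l n).
rewrite mulr_sumr; apply: ler_sum => l _.
rewrite ExZ; last by case: (h2 l n).
by rewrite ler_wpM2l//; exact: (image_ns_bound (mH l) (H2 l) (H0 l)).
Qed.

Let psin2 n : L2 P (fun w => psin n w - v).
Proof.
apply: L2B; last exact: L2_cst.
by apply: L2Z; apply: L2_sum => i; exact: (image_L2 mpsi psi2 i).
Qed.

(** Reduces the mean-square convergence of [psin] to the uniform second-moment bound on normalized
    sums: the square gains a factor [1 / n]. *)
Let psin_ns n w : (0 < n)%N ->
  psin n w - v = r n * normalized_sum (fun i => psic \o W i) n w.
Proof.
move=> n0; have nn : n%:R != 0 :> R by rewrite pnatr_eq0 -lt0n.
rewrite nsE mulrA r_sqr /psin /psic sumrB sumr_const card_ord -(mulr_natl v).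
by field.
Qed.

Let psin_cvg : Ex P (fun w => (psin n w - v) ^+ 2) @[n --> \oo] --> (0 : R).
Proof.
pose C := Ex P (fun w => psic (W 0%N w) ^+ 2).
have rC : r n * (r n * C) @[n --> \oo] --> (0 : R).
  rewrite -(mul0r (0 * C)); apply: cvgM; first exact: cvg_r.
  by apply: cvgMl; exact: cvg_r.
apply: (squeeze_cvgr _ (cvg_cst 0) rC); near=> n.
have n0 : (0 < n)%N by near: n; exact: nbhs_infty_gt.
rewrite Ex_ge0 /=; last by move=> w; exact: sqr_ge0.
have -> : (fun w => (psin n w - v) ^+ 2) =
    (fun w => r n * (r n * normalized_sum (fun i => psic \o W i) n w ^+ 2)).
  by apply/funext => w; rewrite psin_ns//; ring.
have [_ i2] := image_ns_L2 mpsic psic2 n.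
rewrite ExZ; last exact: L1Z.
rewrite ExZ// ler_wpM2l// ler_wpM2l//.
exact: (image_ns_bound mpsic psic2 psic0).
Unshelve. all: by end_near. Qed.

Let mean_ns l n w : n%:R^-1 * \sum_(i < n) H l (W i w) = r n * hn l n w.
Proof. by rewrite /hn nsE mulrA r_sqr. Qed.

Let Q_bound n w : (0 < n)%N -> 0 <= Q n w /\ Q n w <= q n w.
Proof.
move=> n0; split; first by apply: sumr_ge0 => l _; exact: sqr_ge0.
apply: ler_sum => l _; rewrite mean_ns exprMn ler_wpM2r ?sqr_ge0//.
by rewrite expr2 ler_piMr//; exact: r_le1.
Qed.

Let qE n w : (0 < n)%N -> q n w = Num.sqrt n%:R * Q n w.
Proof.
move=> n0; rewrite /q /Q mulr_sumr; apply: eq_bigr => l _.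
rewrite mean_ns /r; move: (hn l n w) => t; field.
by rewrite gt_eqF// sqrtr_gt0 ltr0n.
Qed.

Let SU n w : R := \sum_(i < n) \sum_(l < k) U l (W i w).
Let SV n w : R := \sum_(i < n) \sum_(l < k) V l (W i w).

Let estimatorE n w : (0 < n)%N ->
  estimator W n w = (n%:R^-1 * SU n w - Q n w) / (psin n w - Q n w).
Proof.
move=> n0; rewrite /estimator.
have e l := empirical_centering (fun i : 'I_n => y l (W i w)) (fun i : 'I_n => z l (W i w)) (m l) n0.
congr (_ / _).
  rewrite (eq_bigr (fun l => n%:R^-1 * (\sum_(i < n) U l (W i w)) -
      (n%:R^-1 * \sum_(i < n) H l (W i w)) ^+ 2)); last by move=> l _; have [] := e l.
  by rewrite sumrB -mulr_sumr exchange_big.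
rewrite (eq_bigr (fun l => n%:R^-1 * (\sum_(i < n) V l (W i w) / 2) -
    (n%:R^-1 * \sum_(i < n) H l (W i w)) ^+ 2)); last by move=> l _; have [] := e l.
by rewrite sumrB -mulr_sumr exchange_big.
Qed.

Let TE n w : (0 < n)%N -> psin n w - Q n w != 0 ->
  T n w = (v * Z n w - (1 - S) * q n w) / (psin n w - Q n w).
Proof.
move=> n0 D0.
have rn0 : Num.sqrt n%:R != 0 :> R by rewrite gt_eqF// sqrtr_gt0 ltr0n.
have v0 : v != 0 by rewrite gt_eqF.
have psiE : psin n w = n%:R^-1 * (SV n w / 2).
  rewrite /psin /SV mulr_suml; congr (_ * _); apply: eq_bigr => i _.
  by rewrite /psi mulr_suml.
have ZE : Z n w = (Num.sqrt n%:R)^-1 * (a * SU n w + b * SV n w).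
  rewrite /Z nsE; congr (_ * _); rewrite /SU /SV !mulr_sumr -big_split/=.
  by apply: eq_bigr => i _; rewrite /phi.
(* Uses [v * a = 1] and [v * b = - S / 2]; the terms [Q n w] from the numerator and the denominator
   combine into the coefficient [1 - S]. *)
have N : v * Z n w - (1 - S) * q n w =
    Num.sqrt n%:R * ((n%:R^-1 * SU n w - Q n w) - S * (psin n w - Q n w)).
  rewrite ZE qE// psiE /b aE -(r_sqr n) /r.
  move: (Num.sqrt _) rn0 => t t0.
  by field; rewrite v0 t0.
rewrite N /T estimatorE// -[RHS]mulrA; congr (_ * _).
by rewrite [RHS]mulrBl mulfK.
Qed.

Lemma estimator_asymptotics : cvg_in_law P T (gaussian
  (a ^+ 2 * (\sum_(l < k) \sum_(l' < k) cov P (U l \o W 0%N) (U l' \o W 0%N))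
    + b ^+ 2 * (\sum_(l < k) \sum_(l' < k) cov P (V l \o W 0%N) (V l' \o W 0%N))
    + 2 * a * b * (\sum_(l < k) \sum_(l' < k) cov P (U l \o W 0%N) (V l' \o W 0%N)))).
Proof.
have U2W l : L2 P (U l \o W 0%N) := image_L2 (mU l) (U2 l) 0%N.
have V2W l : L2 P (V l \o W 0%N) := image_L2 (mV l) (V2 l) 0%N.
rewrite -Ex_sqr_lincomb//; last first.
  under eq_bigr do rewrite (image_Ex (mU _) (U2 _)).
  under [X in _ + _ * X]eq_bigr do rewrite (image_Ex (mV _) (V2 _)).
  exact: centered.
apply: (cvg_in_law_Ex mT) => h ch [M hM].
exact: (ratio_slutsky v_gt0 ch hM (image_ns_L2 mphi phi2)
  (image_ns_bound mphi phi2 phi0) iq q_cvg psin2 psin_cvg mT Q_bound TE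
  (image_clt mphi phi2 phi0 ch hM)).
Qed.

End estimator_limit.

Lemma positive_definite_diag (R : realType) (k : nat) (A : 'M[R]_k) (l : 'I_k) :
  positive_definite A -> 0 < A l l.
Proof.
move=> [_ /(_ (delta_mx 0 l))].
rewrite -rowE trmx_delta -colE !mxE; apply.
apply/negP => /eqP /matrixP /(_ 0 l); rewrite !mxE !eqxx /= => /eqP.
by rewrite oner_eq0.
Qed.

Unset Implicit Arguments.

Theorem proposition5p2 (R : realType)
  (dO : measure_display) (Omega : measurableType dO) (P : probability Omega R)
  (p k : nat) (d : 'I_p -> measure_display)
  (E : forall i : 'I_p, measurableType (d i))
  (X : forall i : 'I_p, {RV P >-> E i})
  (f : {mfun product_space E >-> k.-tuple R})
  (u : {set 'I_p})
  (X' : {RV P >-> subproduct E (~: u)%SET})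
  (W : nat -> {RV P >-> (k.-tuple R * k.-tuple R)%type}) :
  let Y : Omega -> k.-tuple R := output X f in
  let Yu : Omega -> k.-tuple R :=
    fun w => f (pf_merge (subvector u (input X w)) (X' w)) in
  mutually_independent P X ->
  positive_definite (covmx P (component Y)) ->
  (forall l, ('E_P[component Y l ^+ 4] < +oo)%E) ->
  same_law P X' (subvector (~: u)%SET \o input X) ->
  independent2 P (input X) X' ->
  mutually_independent P W ->
  (forall i, same_law P (W i) (fun w => (Y w, Yu w))) ->
  let m (l : 'I_k) : R := fine 'E_P[component Y l] in
  let U (l : 'I_k) (w : Omega) : R :=
    (tnth (W 0%N w).1 l - m l) * (tnth (W 0%N w).2 l - m l) in
  let V (l : 'I_k) (w : Omega) : R :=
    (tnth (W 0%N w).1 l - m l) ^+ 2 + (tnth (W 0%N w).2 l - m l) ^+ 2 in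
  let S : R := sobol_index X f u in
  let a : R := (\sum_(l < k) fine 'V_P[component Y l])^-1 in
  let b : R := - (a / 2) * S in
  let sigma2 : R :=
    a ^+ 2 * (\sum_(l < k) \sum_(l' < k) cov P (U l) (U l'))
    + b ^+ 2 * (\sum_(l < k) \sum_(l' < k) cov P (V l) (V l'))
    + 2 * a * b * (\sum_(l < k) \sum_(l' < k) cov P (U l) (V l')) in
  cvg_in_law P
    (fun N w => Num.sqrt N%:R * (estimator W N w - S))
    (gaussian sigma2).

Proof.
move=> Y Yu iX pd Y4 lX' iX' iW lW m U V S a b sigma2.
have covYE l : cov P (component Y l) (component Y l) = covmx P (component Y) l l.
  by rewrite mxE.
have aE : a = (\tr (covmx P (component Y)))^-1.
  by congr (_^-1); apply: eq_bigr => l _; rewrite -covYE.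
(* With no components the total variance is not positive. All sums are empty, so the estimator, the
   index and [sigma2] are [0], and the limit is the Dirac mass at [0]. *)
have [k0|k0] := posnP k.
  have empty (F : 'I_k -> R) : \sum_(l < k) F l = 0.
    by apply: big1 => -[l lk]; exfalso; move: lk; rewrite k0.
  have -> : sigma2 = 0 by rewrite /sigma2 !empty !mulr0 !addr0.
  have S0 : S = 0 by rewrite /S /sobol_index /mxtrace empty mul0r.
  have mh (h : R -> R) : continuous h -> measurable_fun setT h.
    exact: continuous_measurable_fun.
  apply: (@cvg_in_law_Ex) => [n|h ch _].
    under eq_fun do rewrite /estimator !empty mul0r S0 subr0 mulr0.
    exact: measurable_cst.
  have -> : (fun n => Ex P (h \o (fun w => Num.sqrt n%:R * (estimator W n w - S)))) =
      (fun=> h 0).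
    apply/funext => n; rewrite -[RHS](Ex_cst P (h 0)); congr Ex; apply/funext => w /=.
    by rewrite /estimator !empty mul0r S0 subr0 mulr0.
  rewrite /gaussian eqxx [X in _ --> X](_ : _ = h 0); first exact: cvg_cst.
  rewrite /Ex /Rintegral integral_dirac//; last by apply/measurable_EFinP; exact: mh.
  by rewrite diracT mul1e.
pose phi l (x : product_space E) : R := tnth (f x) l.
have mphi l : measurable_fun setT (phi l).
  exact: (measurableT_comp (measurable_tnth l) (measurable_funP f)).
have minp := measurable_input X.
have mcopy := measurable_frozen_copy X X'.
have lcopy : same_law P (input X) (frozen_copy X X').
  exact: same_law_frozen_copy iX lX' iX'.
have mY l : measurable_fun setT (fun w => phi l (input X w)).
  exact: (measurableT_comp (mphi l) minp).
(* The fourth power is nonnegative, so its finite expectation is the finiteness of the absolute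
   integral. *)
have y4 l : L2 P (fun w => phi l (input X w) ^+ 2).
  split; first exact: measurable_funX.
  have := Y4 l; rewrite unlock => fin.
  apply/integrableP; split.
    by apply/measurable_EFinP; apply: measurable_funX; exact: measurable_funX.
  apply: le_lt_trans fin; rewrite le_eqVlt; apply/orP; left; apply/eqP.
  apply: eq_integral => w _; rewrite gee0_abs ?lee_fin ?sqr_ge0// -exprM.
  by congr EFin.
have y2 l : L2 P (fun w => phi l (input X w)) by split=> //; exact: L2_L1 (y4 l).
have transfer (g : product_space E -> R) : measurable_fun setT g ->
    L1 P (fun w => g (input X w)) ->
    L1 P (fun w => g (frozen_copy X X' w)) /\
    Ex P (fun w => g (input X w)) = Ex P (fun w => g (frozen_copy X X' w)).
  by move=> mg ig; exact: (same_law_integral minp mcopy mg lcopy ig).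
have z4 l : L2 P (fun w => phi l (frozen_copy X X' w) ^+ 2).
  split; first by apply: measurable_funX; exact: (measurableT_comp (mphi l) mcopy).
  have mg : measurable_fun setT (fun x => (phi l x ^+ 2) ^+ 2).
    by apply: measurable_funX; exact: measurable_funX.
  by have [] := transfer _ mg (y4 l).2.
have z2 l : L2 P (fun w => phi l (frozen_copy X X' w)).
  by split; [exact: (measurableT_comp (mphi l) mcopy)|exact: L2_L1 (z4 l)].
have mE l : Ex P (fun w => phi l (input X w)) = m l by rewrite /m Ex_expectation.
have zE l : Ex P (fun w => phi l (frozen_copy X X' w)) = m l.
  by rewrite -mE; have [_ <-] := transfer _ (mphi l) (L2_L1 (y2 l)).
have yc2 l : L2 P (fun w => phi l (input X w) - m l).
  by apply: L2B => //; exact: L2_cst.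
have var l : Ex P (fun w => (phi l (frozen_copy X X' w) - m l) ^+ 2) =
    Ex P (fun w => (phi l (input X w) - m l) ^+ 2).
  have mg : measurable_fun setT (fun x => (phi l x - m l) ^+ 2).
    by apply: measurable_funX; exact: measurable_funB.
  by have [_ <-] := transfer _ mg (yc2 l).2.
have vE : \sum_(l < k) Ex P (fun w => (phi l (input X w) - m l) ^+ 2) =
    \tr (covmx P (component Y)).
  apply: eq_bigr => l _; rewrite -covYE covE.
  by congr Ex; apply/funext => w; rewrite -mE expr2.
have v_gt0 : 0 < \sum_(l < k) Ex P (fun w => (phi l (input X w) - m l) ^+ 2).
  rewrite vE /mxtrace (bigD1 (Ordinal k0))//= ltr_pwDl ?(positive_definite_diag _ pd)//.
  by apply: sumr_ge0 => l _; exact/ltW/positive_definite_diag.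
(* The sum of the means of the [U_l] is the numerator of the Sobol index: expanding the product
   leaves the mean of [Y_l] times its frozen copy minus [m l ^+ 2], as both factors have mean
   [m l]. *)
have numE : \sum_(l < k) Ex P (fun w => (phi l (input X w) - m l) *
      (phi l (frozen_copy X X' w) - m l)) =
    \tr (covmx P (fun l => cond_expectation P
      (g_sigma_algebra_preimage (subvector u \o input X)) (component Y l))).
  apply: eq_bigr => l _; rewrite mxE.
  rewrite (cov_cond_expectation iX lX' iX' (mphi l) (y2 l)).
  have -> : (fun w => (phi l (input X w) - m l) * (phi l (frozen_copy X X' w) - m l)) =
      (fun w => phi l (input X w) * phi l (frozen_copy X X' w) -
        m l * (phi l (input X w) + phi l (frozen_copy X X' w)) + m l ^+ 2).
    by apply/funext => w; ring.
  have i1 := L2M (y2 l) (z2 l).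
  have i2 := L1D (L2_L1 (y2 l)) (L2_L1 (z2 l)).
  rewrite ExD ?Ex_cst; last 2 first.
  - by apply: L1B => //; exact: L1Z.
  - exact: L1_cst.
  rewrite ExB//; last exact: L1Z.
  rewrite ExZ// (ExD (L2_L1 (y2 l)) (L2_L1 (z2 l))) !mE zE.
  by ring.
have mref : measurable_fun setT (fun w => (Y w, Yu w)).
  apply: measurable_fun_pair.
    exact: (measurableT_comp (measurable_funP f) minp).
  exact: (measurableT_comp (measurable_funP f) mcopy).
apply: (estimator_asymptotics mref iW lW y4 z4 mE zE var v_gt0).
- by rewrite /S /sobol_index -/Y -numE -vE.
- by rewrite aE -vE.
Qed.
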